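(* (a) For any domain $D\subset\mathbb{C}^n$, the functions $l_D^{(m)}$, $\ell_D^{(m)}$ (on $D\times D$), $\kappa_D^{(m)}$ and $\hat\kappa_D$ (on $D\times\mathbb{C}^n$) are upper semicontinuous, uniformly in $m\in\mathbb{N}$ at each point; that is, for each of the families $F_m=l_D^{(m)}$, $F_m=\ell_D^{(m)}$, $F_m=\kappa_D^{(m)}$, for every point $a$ of the domain of definition and every $\eta>0$ there is a neighborhood $W$ of $a$ such that $F_m(b)\le F_m(a)+\eta$ for all $b\in W$ and all $m\in\mathbb{N}$, and $\hat\kappa_D$ is upper semicontinuous. (b) For any taut domain $D\subset\mathbb{C}^n$ and any $m\in\mathbb{N}$, the infimum in the definitions of $l_D^{(m)}$, $\ell_D^{(m)}$ and $\kappa_D^{(m)}$ is attained (i.e. there exist $m-1$ intermediate points, respectively $m$ vectors, together with corresponding analytic discs realizing the minimum), and these functions, as well as $\hat\kappa_D$, are continuous.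
   Context: $\mathbb{N}$ is the set of positive integers, $\mathbb{D}$ the open unit disc in $\mathbb{C}$, and $\mathcal{O}(\mathbb{D},D)$ the set of holomorphic maps (analytic discs) $\mathbb{D}\to D$. For $z,w\in D$, $X\in\mathbb{C}^n$: $\ell_D(z,w):=\inf\{|\alpha|:\alpha\in\mathbb{D},\ \exists\varphi\in\mathcal{O}(\mathbb{D},D),\ \varphi(0)=z,\ \varphi(\alpha)=w\}$; $l_D:=\tanh^{-1}\ell_D$; $\kappa_D(z;X):=\inf\{|\alpha|:\alpha\in\mathbb{C},\ \exists\varphi\in\mathcal{O}(\mathbb{D},D),\ \varphi(0)=z,\ \alpha\varphi'(0)=X\}$. For $m\in\mathbb{N}$: $l_D^{(m)}(z,w):=\inf\{\sum_{j=0}^{m-1}l_D(y_j,y_{j+1}): y_0,\dots,y_m\in D,\ y_0=z,\ y_m=w\}$; $\ell_D^{(m)}$ is defined in the same way with $\ell_D$ in place of $l_D$; $\kappa_D^{(m)}(z;X):=\inf\{\sum_{j=1}^m\kappa_D(z;X_j): X_j\in\mathbb{C}^n,\ \sum_{j=1}^mX_j=X\}$; and $\hat\kappa_D(z;X):=\inf_{m\in\mathbb{N}}\kappa_D^{(m)}(z;X)$. The domain $D$ is taut if the space $\mathcal{O}(\mathbb{D},D)$ is normal, i.e. every sequence in it has a subsequence which either converges locally uniformly to an element of $\mathcal{O}(\mathbb{D},D)$ or is compactly divergent. *)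

(* Defs.v *)
From HB Require Import structures.
From mathcomp Require Import all_boot all_order all_algebra.
From mathcomp Require Import complex.
From mathcomp Require Import all_classical all_reals all_analysis.
From mathcomp Require Import ring lra.

Set Implicit Arguments.
Unset Strict Implicit.
Unset Printing Implicit Defensive.

Import Order.TTheory GRing.Theory Num.Theory.
Import numFieldNormedType.Exports.

Local Open Scope classical_set_scope.
Local Open Scope ring_scope.

(* R[i] packaged as a numClosedFieldType, so that the norm topology which
   MathComp-Analysis puts on any numFieldType is found by unification. The norm
   `|z| is itself an element of Cplx R; [modulus z] is its value in R. *)
Definition Cplx (R : realType) : numClosedFieldType := R[i]%C.

Definition modulus (R : realType) (z : Cplx R) : R := Normc.normc z.

Lemma modulusE (R : realType) (z : Cplx R) : `|z| = (modulus z)%:C%C.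
Proof. by []. Qed.

Section Artanh.
Context {R : realType}.
Implicit Types x t : R.

Definition tanh t : R := (expR t - expR (- t)) / (expR t + expR (- t)).

Definition artanh x : R := ln ((1 + x) / (1 - x)) / 2.

Lemma tanhE t : tanh t = (expR (2 * t) - 1) / (expR (2 * t) + 1).
Proof.
have e0 := expR_gt0 t.
rewrite /tanh expRN (_ : 2 * t = t + t); last by ring.
rewrite expRD; move: (expR t) e0 => u u0.
by field; apply/andP; split; apply/lt0r_neq0; nra.
Qed.

Lemma artanhK x : -1 < x -> x < 1 -> tanh (artanh x) = x.
Proof.
move=> x1 x2; rewrite tanhE /artanh [2 * _]mulrC divfK ?pnatr_eq0//.
rewrite lnK; first by field; apply/andP; split; apply/lt0r_neq0; lra.
by rewrite posrE divr_gt0//; lra.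
Qed.

Lemma tanhK t : artanh (tanh t) = t.
Proof.
have e0 := expR_gt0 (2 * t); rewrite tanhE /artanh.
rewrite (_ : (1 + _) / (1 - _) = expR (2 * t)).
  by rewrite expRK mulrC mulKf ?pnatr_eq0.
by move: (expR _) e0 => u u0; field; apply/andP; split; apply/lt0r_neq0; lra.
Qed.

End Artanh.

Section Semicontinuity.
Context {R : realType} {T : topologicalType}.

Definition usc_on (A : set T) (f : T -> R) : Prop :=
  forall a, A a -> forall eta : R, 0 < eta ->
    \forall b \near within A (nbhs a), f b <= f a + eta.

(* The neighborhood of a does not depend on m >= 1. *)
Definition usc_on_uniformly (A : set T) (F : nat -> T -> R) : Prop :=
  forall a, A a -> forall eta : R, 0 < eta ->
    \forall b \near within A (nbhs a),
      forall m, (0 < m)%N -> F m b <= F m a + eta.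

End Semicontinuity.

Section AnalyticDiscs.
Context {R : realType} {n : nat}.
Notation C := (Cplx R).
Notation V := 'rV[C]_n.
Implicit Types (D : set V) (z w X : V) (phi psi : C -> V) (m : nat).

Definition domain D : Prop := [/\ open D, connected D & D !=set0].

Definition unit_disc : set C := [set lambda | `|lambda| < 1].

(* Analytic discs are represented by total functions on C of which only the
   restriction to the unit disc is used; [derivable] over the field C is complex
   differentiability. *)
Definition analytic_disc D : set (C -> V) :=
  [set phi | forall lambda, unit_disc lambda ->
     derivable phi lambda 1 /\ D (phi lambda)].

(* When D is a domain, any two of its points lie on a common analytic disc, and
   through each point there are discs in all directions. So for points of D and
   m >= 1 the real infima below are over nonempty sets bounded below by 0, and
   the convention inf set0 = 0 plays no role; moreover 0 <= ell D z w < 1. *)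

Definition disc_through D z w (alpha : C) phi : Prop :=
  [/\ unit_disc alpha, analytic_disc D phi, phi 0 = z & phi alpha = w].

Definition ell D z w : R :=
  inf [set modulus alpha | alpha in
        [set alpha | exists phi, disc_through D z w alpha phi]].

Definition lempert D z w : R := artanh (ell D z w).

Definition disc_tangent D z X (alpha : C) phi : Prop :=
  [/\ analytic_disc D phi, phi 0 = z & alpha *: derive1 phi 0 = X].

Definition kappa D z X : R :=
  inf [set modulus alpha | alpha in
        [set alpha | exists phi, disc_tangent D z X alpha phi]].

(* Only y 0, ..., y m are relevant. *)
Definition chain D m z w (y : nat -> V) : Prop :=
  [/\ forall j, (j <= m)%N -> D (y j), y 0%N = z & y m = w].

Definition chain_sum (f : V -> V -> R) m (y : nat -> V) : R :=
  \sum_(j < m) f (y j) (y j.+1).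

Definition chain_inf D (f : V -> V -> R) m z w : R :=
  inf [set chain_sum f m y | y in chain D m z w].

Definition lempert_m D m z w : R := chain_inf D (lempert D) m z w.

Definition ell_m D m z w : R := chain_inf D (ell D) m z w.

Definition decomposition m X (Xs : 'I_m -> V) : Prop := \sum_j Xs j = X.

Definition kappa_m D m z X : R :=
  inf [set \sum_j kappa D z (Xs j) | Xs in @decomposition m X].

Definition kappa_hat D z X : R :=
  inf [set kappa_m D m z X | m in [set m | (0 < m)%N]].

Definition converges_locally_uniformly (phi : nat -> C -> V) psi : Prop :=
  forall lambda, unit_disc lambda ->
    exists2 U, nbhs lambda U & {uniform U, phi @ \oo --> psi}.

Definition compactly_divergent D (phi : nat -> C -> V) : Prop :=
  forall (K : set C) (L : set V),
    compact K -> K `<=` unit_disc -> compact L -> L `<=` D ->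
    \forall k \near \oo, (phi k @` K) `&` L = set0.

Definition taut D : Prop :=
  forall phi : nat -> C -> V, (forall k, analytic_disc D (phi k)) ->
  exists2 s : nat -> nat, {homo s : i j / (i < j)%N} &
    (exists2 psi, analytic_disc D psi &
       converges_locally_uniformly (phi \o s) psi)
    \/ compactly_divergent D (phi \o s).

(* A minimizing chain for the functional f, together with an analytic disc
   realizing ell_D, hence also l_D = artanh ell_D, for each of its steps. *)
Definition chain_inf_attained D (f : V -> V -> R) m z w : Prop :=
  exists y : nat -> V,
    [/\ chain D m z w y,
        chain_sum f m y = chain_inf D f m z w &
        forall j, (j < m)%N -> exists alpha phi,
          disc_through D (y j) (y j.+1) alpha phi /\
          modulus alpha = ell D (y j) (y j.+1)].

Definition kappa_m_attained D m z X : Prop :=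
  exists Xs : 'I_m -> V,
    [/\ decomposition X Xs,
        \sum_j kappa D z (Xs j) = kappa_m D m z X &
        forall j, exists alpha phi,
          disc_tangent D z (Xs j) alpha phi /\
          modulus alpha = kappa D z (Xs j)].

End AnalyticDiscs.

(* Main.v *)
Require Import Defs.
From mathcomp Require Import all_boot all_order all_algebra.
From mathcomp Require Import complex.
From mathcomp Require Import all_classical all_reals all_analysis.
From mathcomp Require Import ring lra.
Set Implicit Arguments.
Unset Strict Implicit.
Unset Printing Implicit Defensive.
Import Order.TTheory GRing.Theory Num.Theory.
Import numFieldNormedType.Exports.
Local Open Scope classical_set_scope.
Local Open Scope ring_scope.

(** Upper semicontinuity comes from perturbing discs. Two points of a domain
    lie on a common analytic disc ([connected_reachable]). If [phi] is a disc
    with [phi 0 = z] and [phi a = w], then [phi], slightly shrunk, stays in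
    the open set [D] after addition of an affine function with small
    coefficients ([near_perturbed_disc]), which can be chosen so that the new
    disc passes through given points near [z] and [w], or has a given
    derivative at 0 near that of [phi]. Hence [ell] and [kappa] are upper
    semicontinuous. So are the infima over chains of m steps and over
    decompositions into m vectors: only the end points of a nearly minimal
    chain, or one of the vectors, have to be moved. These infima decrease in
    m, because a chain can rest at its last point and a decomposition can be
    completed by zeros; being nonnegative they are, at a given point, almost
    constant from some m on, and this gives neighborhoods that do not depend
    on m ([usc_uniformly_of_decreasing]).

    In a taut domain, discs with centers converging in [D] do not diverge
    compactly, so that a subsequence converges locally uniformly
    ([taut_extraction]). Their values at converging parameters converge, and
    so do their derivatives at 0. Nearly minimal chains therefore have a limit
    chain, obtained link by link ([chain_extraction]), as soon as the
    parameters of the discs are bounded away from the unit circle: for the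
    Lempert function any bound on the sum does this, for [ell] a bound less
    than 1. Limits of decompositions are obtained in the same way. The limits
    show that the infima are attained and, applied to moving points, that they
    are lower semicontinuous ([chain_limit], [kappa_m_limit]).

    Convergence of the derivatives is Weierstrass' theorem. As discs are only
    assumed to be complex differentiable, it rests on Goursat's bisection
    argument ([circ_eq0]). In the coordinate z of e^z, this argument shows
    that the Cauchy integral of (g (e^z) - g 0) / e^z over circles about 0
    does not depend on the radius, whence a bound of the derivative at 0 by
    the supremum of the function ([cauchy_estimate]).

    For [kappa_hat] the number of vectors is unbounded and decompositions need
    not have limits. Here homogeneity and the same compactness of discs give
    [kappa D z Y <= (1 + e) * kappa D z' Y] for [z'] near [z] and for all [Y]
    at once ([kappa_comparison]). This estimate passes to sums, thus to
    [kappa_hat], whose dependence on the vector is controlled by the triangle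
    inequality. *)

(** * Closed differential forms on a rectangle *)

Section ClosedForms.
Context {R : realType}.
Implicit Types (a b c d s t : R).

Lemma primitive_exists (h : R -> R) (a u : R) : a < u ->
  (forall x, a <= x <= u -> {for x, continuous h}) ->
  exists F : R -> R, forall x, a < x < u -> is_derive x 1 F (h x).
Proof.
move=> au hc; exists (fun x => (\int[lebesgue_measure]_(t in `[a, x]) h t)%R).
move=> x /andP[ax xu].
have hi : lebesgue_measure.-integrable `[a, u] (EFin \o h).
  apply: continuous_compact_integrable; first exact: segment_compact.
  apply: continuous_in_subspaceT => z /[1!inE]; rewrite /= in_itv/= => zau.
  exact: hc.
have [dF FE] := continuous_FTC1_closed xu hi ax (hc x ltac:(by rewrite !ltW)).
by apply: DeriveDef; [exact: dF|rewrite -derive1E FE].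
Qed.

(** Integrals occur below only as increments of primitives, so that the mean
    value inequality takes the place of the bound of an integral by a
    supremum. *)
Lemma increment_le (F f : R -> R) (K a b : R) : a <= b ->
  (forall x, a <= x <= b -> is_derive x 1 F (f x)) ->
  (forall x, a <= x <= b -> `|f x| <= K) ->
  `|F b - F a| <= K * (b - a).
Proof.
move=> ab dF fK.
have [||x] := @MVT_segment R F f a b ab.
- by move=> x; rewrite in_itv/= => /andP[ax xb]; apply: dF; rewrite !ltW.
- apply: derivable_within_continuous => x; rewrite in_itv/= => xab.
  exact: (@ex_derive _ _ _ _ _ _ _ (dF x xab)).
rewrite in_itv/= => xab ->; rewrite normrM (ger0_norm (x := b - a)) ?subr_ge0//.
by rewrite ler_wpM2r ?subr_ge0// fK.
Qed.

(** Total differentiability of [P] at (s, t), with partial derivatives [p] and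
    [q]. *)
Definition affine_approx (P : R -> R -> R) s t (p q : R) :=
  forall e, 0 < e -> exists2 del, 0 < del &
    forall s' t', `|s' - s| <= del -> `|t' - t| <= del ->
      `|P s' t' - P s t - p * (s' - s) - q * (t' - t)|
         <= e * (`|s' - s| + `|t' - t|).

Section Circulation.
Variables (P Q A B : R -> R -> R) (s0 t0 w h : R).
Hypotheses (w_gt0 : 0 < w) (h_gt0 : 0 < h).
Hypothesis dA : forall s t, s0 <= s <= s0 + w -> t0 <= t <= t0 + h ->
  is_derive s 1 (A t) (P s t).
Hypothesis dB : forall s t, s0 <= s <= s0 + w -> t0 <= t <= t0 + h ->
  is_derive t 1 (B s) (Q s t).
(* The shared [q] expresses that dP/dt = dQ/ds. *)
Hypothesis closed_PQ : forall s t, s0 <= s <= s0 + w -> t0 <= t <= t0 + h ->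
  exists p q r, affine_approx P s t p q /\ affine_approx Q s t q r.

(** The integral of the form P ds + Q dt around the boundary of the rectangle
    with opposite corners (a, c) and (b, d), in terms of primitives [A] of [P]
    along s and [B] of [Q] along t. *)
Definition circ a b c d :=
  (A c b - A c a) + (B b d - B b c) - (A d b - A d a) - (B a d - B a c).

(** The affine part of the form contributes nothing, because the common cross
    derivative [q] enters the horizontal and the vertical sides with opposite
    signs. What is left is a remainder small compared with the size of the
    rectangle, integrated along sides of that size. *)
Lemma circ_small s t : s0 <= s <= s0 + w -> t0 <= t <= t0 + h ->
  forall e, 0 < e -> exists2 del, 0 < del & forall a b c d,
    a <= s <= b -> c <= t <= d -> s0 <= a -> b <= s0 + w ->
    t0 <= c -> d <= t0 + h -> b - a <= del -> d - c <= del ->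
    `|circ a b c d| <= e * (b - a + (d - c)) ^+ 2.
Proof.
move=> sW tW e e0; have [p [q [r [hP hQ]]]] := closed_PQ sW tW.
have e20 : 0 < e / 2 by rewrite divr_gt0.
have [d1 d10 {}hP] := hP _ e20; have [d2 d20 {}hQ] := hQ _ e20.
exists (Num.min d1 d2); first by rewrite lt_min d10.
move=> a b c d /andP[as_ sb] /andP[ct td] sa bs tc dt.
rewrite !le_min => /andP[ba1 ba2] /andP[dc1 dc2].
have ab : a <= b by apply: le_trans sb.
have cd : c <= d by apply: le_trans td.
have nle (x y u v : R) : u <= x <= v -> u <= y <= v -> `|x - y| <= v - u.
  by move=> /andP[? ?] /andP[? ?]; rewrite ler_norml; apply/andP; split; lra.
have hP' x y : a <= x <= b -> c <= y <= d ->
  `|P x y - P s t - p * (x - s) - q * (y - t)| <= e / 2 * (b - a + (d - c)).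
  move=> xab ycd.
  have xs : `|x - s| <= b - a by apply: nle => //; apply/andP.
  have yt : `|y - t| <= d - c by apply: nle => //; apply/andP.
  apply: le_trans (hP _ _ _ _) _; [lra|lra|].
  by rewrite ler_wpM2l ?(ltW e20)// lerD.
have hQ' x y : a <= x <= b -> c <= y <= d ->
  `|Q x y - Q s t - q * (x - s) - r * (y - t)| <= e / 2 * (b - a + (d - c)).
  move=> xab ycd.
  have xs : `|x - s| <= b - a by apply: nle => //; apply/andP.
  have yt : `|y - t| <= d - c by apply: nle => //; apply/andP.
  apply: le_trans (hQ _ _ _ _) _; [lra|lra|].
  by rewrite ler_wpM2l ?(ltW e20)// lerD.
have aab : a <= a <= b by rewrite lexx.
have bab : a <= b <= b by rewrite lexx andbT.
have ccd : c <= c <= d by rewrite lexx.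
have dcd : c <= d <= d by rewrite lexx andbT.
have cb : t0 <= c <= t0 + h by lra.
have db : t0 <= d <= t0 + h by lra.
have ab' : s0 <= a <= s0 + w by lra.
have bb' : s0 <= b <= s0 + w by lra.
(* The corrections by [q * (d - c)] and [q * (b - a)] are the circulation of
   the affine part, which cancels in the sum. *)
have HA := @increment_le (fun x => A c x - A d x + q * (d - c) * x)
   (fun x => P x c - P x d + q * (d - c)) (e * (b - a + (d - c))) a b ab.
have HB := @increment_le (fun y => B b y - B a y - q * (b - a) * y)
   (fun y => Q b y - Q a y - q * (b - a)) (e * (b - a + (d - c))) c d cd.
have {}HA : `|(A c b - A c a) - (A d b - A d a) + q * (d - c) * (b - a)|
    <= e * (b - a + (d - c)) * (b - a).
  rewrite [X in `|X|](_ : _ = (A c b - A d b + q * (d - c) * b) -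
     (A c a - A d a + q * (d - c) * a)); last by ring.
  apply: HA => x xab.
    have xs : s0 <= x <= s0 + w by lra.
    have := dA xs cb; have := dA xs db => dAd dAc.
    apply: (@is_deriveD _ _ _ (fun x => A c x - A d x)
             (fun x => q * (d - c) * x)).
    apply: (is_derive_eq (is_deriveZ _ _)).
    by rewrite /GRing.scale/= mulr1.
  have h1 := hP' x c xab ccd; have h2 := hP' x d xab dcd.
  rewrite [X in `|X|](_ : _ = (P x c - P s t - p * (x - s) - q * (c - t)) -
    (P x d - P s t - p * (x - s) - q * (d - t))); last by ring.
  by apply: le_trans (ler_normB _ _) _; lra.
have {}HB : `|(B b d - B b c) - (B a d - B a c) - q * (d - c) * (b - a)|
    <= e * (b - a + (d - c)) * (d - c).
  rewrite [X in `|X|](_ : _ = (B b d - B a d - q * (b - a) * d) -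
     (B b c - B a c - q * (b - a) * c)); last by ring.
  apply: HB => y ycd.
    have yt : t0 <= y <= t0 + h by lra.
    have := dB ab' yt; have := dB bb' yt => dBb dBa.
    apply: (@is_deriveB _ _ _ (fun x => B b x - B a x)
             (fun x => q * (b - a) * x)).
    apply: (is_derive_eq (is_deriveZ _ _)).
    by rewrite /GRing.scale/= mulr1.
  have h1 := hQ' a y aab ycd; have h2 := hQ' b y bab ycd.
  rewrite [X in `|X|](_ : _ = (Q b y - Q s t - q * (b - s) - r * (y - t)) -
    (Q a y - Q s t - q * (a - s) - r * (y - t))); last by ring.
  by apply: le_trans (ler_normB _ _) _; lra.
rewrite [X in `|X|](_ : _ =
  ((A c b - A c a) - (A d b - A d a) + q * (d - c) * (b - a)) +
  ((B b d - B b c) - (B a d - B a c) - q * (d - c) * (b - a))); last first.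
  by rewrite /circ; ring.
apply: le_trans (ler_normD _ _) _; apply: le_trans (lerD HA HB) _.
by rewrite -mulrDr expr2 mulrA.
Qed.

Let cell (k : nat) (z : R * R) :=
  circ z.1 (z.1 + w / 2 ^+ k) z.2 (z.2 + h / 2 ^+ k).

(** The circulations around the four quarters of a cell add up to the
    circulation around the cell. *)
Lemma circ_quarter k (z : R * R) : exists z' : R * R,
  [/\ z'.1 = z.1 \/ z'.1 = z.1 + w / 2 ^+ k.+1,
      z'.2 = z.2 \/ z'.2 = z.2 + h / 2 ^+ k.+1 &
      `|cell k z| <= 4 * `|cell k.+1 z'|].
Proof.
have e2 x : x / 2 ^+ k = x / 2 ^+ k.+1 + x / 2 ^+ k.+1 :> R.
  by rewrite exprS; field.
case: z => x y; rewrite /cell /= !(e2 w) !(e2 h).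
set u := w / 2 ^+ k.+1; set v := h / 2 ^+ k.+1.
have -> : circ x (x + (u + u)) y (y + (v + v)) = circ x (x + u) y (y + v) +
  circ (x + u) (x + u + u) y (y + v) +
  circ x (x + u) (y + v) (y + v + v) +
  circ (x + u) (x + u + u) (y + v) (y + v + v).
  by rewrite /circ !addrA; ring.
have n4 (a b c d : R) : `|a + b + c + d| <= `|a| + `|b| + `|c| + `|d|.
  by do 2![apply: le_trans (ler_normD _ _) _; rewrite lerD2r];
     exact: ler_normD.
have {}n4 := n4 (circ x (x + u) y (y + v)) (circ (x + u) (x + u + u) y (y + v))
  (circ x (x + u) (y + v) (y + v + v))
  (circ (x + u) (x + u + u) (y + v) (y + v + v)).
set T := `|_ + _ + _ + _| in n4 *.
have [h1|h1] := leP T (4 * `|circ x (x + u) y (y + v)|).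
  by exists (x, y); split; [left|left|].
have [h2|h2] := leP T (4 * `|circ (x + u) (x + u + u) y (y + v)|).
  by exists (x + u, y); split; [right|left|].
have [h3|h3] := leP T (4 * `|circ x (x + u) (y + v) (y + v + v)|).
  by exists (x, y + v); split; [left|right|].
exists (x + u, y + v); split; [by right|by right|rewrite /=].
by lra.
Qed.

(** At each bisection the corner of the cell either stays or advances by the
    new mesh. The corners increase, the opposite ones decrease, and the
    supremum of the corners lies in all the cells. *)
Lemma bisection_limit (x : nat -> R) (x0 v : R) : 0 < v -> x 0%N = x0 ->
  (forall k, x k.+1 = x k \/ x k.+1 = x k + v / 2 ^+ k.+1) ->
  [/\ forall k, x0 <= x k, forall k, x k + v / 2 ^+ k <= x0 + v &
   exists l, forall k, x k <= l <= x k + v / 2 ^+ k].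
Proof.
move=> v0 x00 xS.
have vk k : 0 < v / 2 ^+ k by rewrite divr_gt0// exprn_gt0.
have e2 k : v / 2 ^+ k = v / 2 ^+ k.+1 + v / 2 ^+ k.+1.
  by rewrite exprS; field; rewrite expf_neq0.
have up k : x k <= x k.+1 by have := xS k; have := vk k.+1; lra.
have dn k : x k.+1 + v / 2 ^+ k.+1 <= x k + v / 2 ^+ k.
  by have := xS k; have := vk k.+1; rewrite (e2 k); lra.
have mono j k : (j <= k)%N -> x j <= x k.
  move=> /subnK <-; elim: (k - j)%N => // i IH.
  by rewrite addSn (le_trans IH).
have anti j k : (j <= k)%N -> x k + v / 2 ^+ k <= x j + v / 2 ^+ j.
  move=> /subnK <-; elim: (k - j)%N => // i IH.
  by rewrite addSn (le_trans _ IH).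
have cross j k : x j <= x k + v / 2 ^+ k.
  have [jk|/ltnW kj] := leqP j k.
    by have := mono _ _ jk; have := vk k; lra.
  by have := anti _ _ kj; have := vk j; lra.
split.
- by move=> k; rewrite -x00 mono.
- by move=> k; have := anti 0%N k (leq0n k); rewrite x00 expr0 divr1.
exists (sup (range x)) => k; apply/andP; split.
  apply: ub_le_sup; last by exists k.
  by exists (x k + v / 2 ^+ k) => _ [j _ <-].
apply: ge_sup; first by exists (x k); exists k.
by move=> _ [j _ <-].
Qed.

(** Goursat's argument. Repeated bisection finds a cell of mesh 2^-k whose
    circulation is at least 4^-k times the initial one, whereas near the limit
    point of these cells [circ_small] makes it negligible compared with 4^-k. *)
Theorem circ_eq0 : circ s0 (s0 + w) t0 (t0 + h) = 0.
Proof.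
pose next k z := projT1 (cid (circ_quarter k z)).
pose z := fix z k := if k is j.+1 then next j (z j) else (s0, t0).
have zS k : [/\ (z k.+1).1 = (z k).1 \/ (z k.+1).1 = (z k).1 + w / 2 ^+ k.+1,
      (z k.+1).2 = (z k).2 \/ (z k.+1).2 = (z k).2 + h / 2 ^+ k.+1 &
      `|cell k (z k)| <= 4 * `|cell k.+1 (z k.+1)|].
  by rewrite /= /next; case: cid.
have [xl xr [s sP]] := @bisection_limit (fun k => (z k).1) s0 w w_gt0 erefl
  (fun k => let: And3 a _ _ := zS k in a).
have [yl yr [t tP]] := @bisection_limit (fun k => (z k).2) t0 h h_gt0 erefl
  (fun k => let: And3 _ a _ := zS k in a).
have zk k : `|cell 0%N (z 0%N)| <= 4 ^+ k * `|cell k (z k)|.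
  elim: k => [|k IH]; first by rewrite mul1r.
  apply: le_trans IH _; rewrite exprSr -mulrA ler_wpM2l ?exprn_ge0//.
  by have [] := zS k.
have : cell 0%N (z 0%N) = circ s0 (s0 + w) t0 (t0 + h).
  by rewrite /cell /= !expr0 !divr1.
move=> <-; apply/normr0_eq0/le_anti; rewrite normr_ge0 andbT.
apply/ler_addgt0Pr => e e0; rewrite add0r.
have sW : s0 <= s <= s0 + w.
  by have := sP 0%N; rewrite /= expr0 divr1.
have tW : t0 <= t <= t0 + h.
  by have := tP 0%N; rewrite /= expr0 divr1.
have wh0 : 0 < (w + h) ^+ 2 by rewrite exprn_gt0// addr_gt0.
have [del del0 small] := circ_small sW tW (divr_gt0 e0 wh0).
have [k kP] : exists k, (w + h) / 2 ^+ k <= del.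
  have [k hk] : exists k, (w + h) / del < k%:R.
    exists (Num.bound ((w + h) / del)).
    by rewrite archi_boundP// divr_ge0 ?ltW// addr_gt0.
  exists k; rewrite ler_pdivrMr ?exprn_gt0// mulrC -ler_pdivrMr//.
  apply/ltW/(lt_trans hk); rewrite -natrX ltr_nat; exact: ltn_expl.
have w2 : 0 < w / 2 ^+ k by rewrite divr_gt0// exprn_gt0.
have h2 : 0 < h / 2 ^+ k by rewrite divr_gt0// exprn_gt0.
have whk : (w + h) / 2 ^+ k = w / 2 ^+ k + h / 2 ^+ k by rewrite mulrDl.
apply: le_trans (zk k) _.
have -> : e = 4 ^+ k * (e / (w + h) ^+ 2 * ((w + h) / 2 ^+ k) ^+ 2).
  have -> : (4 : R) ^+ k = 2 ^+ k ^+ 2 by rewrite exprAC expr2 -natrM.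
  by field; rewrite expf_neq0//= gt_eqF// addr_gt0.
rewrite ler_wpM2l ?exprn_ge0//.
have := small (z k).1 ((z k).1 + w / 2 ^+ k) (z k).2 ((z k).2 + h / 2 ^+ k).
have -> : (z k).1 + w / 2 ^+ k - (z k).1 + ((z k).2 + h / 2 ^+ k - (z k).2) =
  (w + h) / 2 ^+ k by rewrite whk; ring.
apply.
- exact: sP.
- exact: tP.
- exact: xl.
- exact: xr.
- exact: yl.
- exact: yr.
- by lra.
- by lra.
Qed.

End Circulation.
End ClosedForms.

(** * The modulus of complex numbers *)

Section Modulus.
Context {R : realType}.
Notation C := (Cplx R).
Implicit Types (z w : C) (x e : R).

Lemma le_normC z e : (`|z| <= (e%:C)%C) = (modulus z <= e).
Proof. by rewrite modulusE lecR. Qed.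

Lemma lt_normC z e : (`|z| < (e%:C)%C) = (modulus z < e).
Proof. by rewrite modulusE ltcR. Qed.

Lemma posC_real (e : C) : 0 < e -> exists2 r : R, 0 < r & e = (r%:C)%C.
Proof.
case: e => a b; rewrite ltcE/= => /andP[/eqP b0 a0].
by exists a => //; apply/eqP; rewrite eq_complex/= eqxx b0 eqxx.
Qed.

Lemma modulus_ge0 z : 0 <= modulus z.
Proof. by case: z => a b; exact: sqrtr_ge0. Qed.

Lemma modulusM z w : modulus (z * w) = modulus z * modulus w.
Proof. exact: Normc.normcM. Qed.

Lemma modulusV z : modulus z^-1 = (modulus z)^-1.
Proof. exact: Normc.normcV. Qed.

Lemma modulus_real x : modulus (x%:C)%C = `|x|.
Proof. by rewrite /modulus/= expr0n/= addr0 sqrtr_sqr. Qed.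

Lemma modulus0 : modulus (0 : C) = 0.
Proof. by rewrite -[0]/((0%:C)%C) modulus_real normr0. Qed.

Lemma modulus1 : modulus (1 : C) = 1.
Proof. by rewrite -[1]/((1%:C)%C) modulus_real normr1. Qed.

Lemma modulus_eq0 z : (modulus z == 0) = (z == 0).
Proof. by apply/eqP/eqP => [/Normc.eq0_normc//|->]; rewrite modulus0. Qed.

Lemma modulus_gt0 z : (0 < modulus z) = (z != 0).
Proof. by rewrite lt_def modulus_ge0 andbT modulus_eq0. Qed.

Lemma modulusN z : modulus (- z) = modulus z.
Proof. by apply: complexI; rewrite -!modulusE normrN. Qed.

Lemma le_modulusD z w : modulus (z + w) <= modulus z + modulus w.
Proof. exact: le_normcD. Qed.

Lemma le_modulusB z w : modulus (z - w) <= modulus z + modulus w.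
Proof. by rewrite -(modulusN w) le_modulusD. Qed.

Lemma le_Re_modulus z : `|complex.Re z| <= modulus z.
Proof.
case: z => a b; rewrite /modulus/= -sqrtr_sqr ler_sqrt ?lerDl ?sqr_ge0//.
by rewrite addr_ge0 ?sqr_ge0.
Qed.

Lemma le_Im_modulus z : `|complex.Im z| <= modulus z.
Proof.
case: z => a b; rewrite /modulus/= -sqrtr_sqr ler_sqrt ?lerDr ?sqr_ge0//.
by rewrite addr_ge0 ?sqr_ge0.
Qed.

Lemma modulus_le_ReIm z : modulus z <= `|complex.Re z| + `|complex.Im z|.
Proof.
case: z => a b; rewrite /modulus/=.
rewrite -(ler_pXn2r (ltn0Sn 1)) ?nnegrE ?addr_ge0 ?sqrtr_ge0//.
rewrite sqr_sqrtr ?addr_ge0 ?sqr_ge0// sqrrD !real_normK ?num_real//.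
by rewrite -addrA lerD2l lerDr mulrn_wge0// mulr_ge0.
Qed.

Lemma modulus2 : modulus (2 : C) = 2.
Proof.
have -> : (2 : C) = ((2 : R)%:C)%C by rewrite rmorph_nat.
by rewrite modulus_real ger0_norm.
Qed.

Lemma modulusX z N : modulus (z ^+ N) = modulus z ^+ N.
Proof. by elim: N => [|N IH]; rewrite ?expr0 ?modulus1// !exprS modulusM IH.
  Qed.

Lemma unit_discE z : unit_disc z <-> modulus z < 1.
Proof. by rewrite /unit_disc/= -[1 in X in X <-> _]/((1%:C)%C) lt_normC. Qed.

Lemma nbhs_modulusP (z : C) (U : set C) :
  nbhs z U <-> exists2 e, 0 < e & forall w, modulus (w - z) < e -> U w.
Proof.
split.
  move=> /nbhs_ballP[e /= /posC_real[r r0 ->] eU]; exists r => // w wz.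
  apply: eU; rewrite -ball_normE /ball_/= distrC lt_normC//.
move=> [e e0 eU]; apply/nbhs_ballP; exists (e%:C)%C => /=;
  first by rewrite ltcR.
by move=> w; rewrite -ball_normE /ball_/= distrC lt_normC => /eU.
Qed.

End Modulus.

(** * First-order approximation *)

Section Derivability.

Lemma is_deriveP (K : numFieldType) (V : normedModType K) (f : K -> V) (x : K)
  (l : V) :
  is_derive x 1 f l <->
  forall e : K, 0 < e -> \forall h \near 0,
    `|f (h + x) - f x - h *: l| <= e * `|h|.
Proof.
split.
  move=> [/cvg_ex[l' df] fl] e e0.
  have ll' : l' = l by rewrite -fl; apply/esym/cvg_lim.
  move: df; rewrite {}ll' => /cvgrPdist_le/(_ _ e0).
  rewrite near_withinE; apply: filterS => h hP.
  have [->|h0] := eqVneq h 0; first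
    by rewrite add0r subrr scale0r subr0 !normr0 mulr0.
  move/(_ h0): hP => /=; rewrite [_%:A]mulr1 => hP.
  rewrite -(scalerKV h0 (f (h + x) - f x)) -scalerBr normrZ mulrC.
  by rewrite ler_wpM2r// distrC.
move=> H.
have df : h^-1 *: ((f \o shift x) (h *: 1) - f x) @[h --> 0^'] --> l.
  apply/cvgrPdist_le => e /H; rewrite near_withinE; apply: filterS => h hP h0/=.
  rewrite [_%:A]mulr1 -(@ler_pM2l _ `|h|) ?normr_gt0// -normrZ scalerBr.
  by rewrite scalerKV// distrC mulrC.
by apply: DeriveDef; [apply/cvg_ex; exists l|apply/cvg_lim].
Qed.

Context {R : realType}.
Notation C := (Cplx R).

Lemma is_derive_modulusP (f : C -> C) (x l : C) :
  is_derive x 1 f l <->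
  forall e : R, 0 < e -> exists2 del, 0 < del &
    forall h, modulus h < del -> modulus (f (h + x) - f x - h * l) <= e *
      modulus h.
Proof.
split.
  move=> /is_deriveP H e e0; have := H (e%:C)%C; rewrite ltcR => /(_ e0).
  move=> /nbhs_modulusP[del del0 dP]; exists del => // h hd.
  have := dP h; rewrite subr0 => /(_ hd).
  by rewrite (modulusE h) -rmorphM le_normC.
move=> H; apply/is_deriveP => e /posC_real[r r0 ->].
have [del del0 dP] := H r r0; apply/nbhs_modulusP; exists del => // h.
by rewrite subr0 => /dP; rewrite (modulusE h) -rmorphM le_normC.
Qed.
End Derivability.

(** * The complex exponential *)

Section ComplexExponential.
Context {R : realType}.
Notation C := (Cplx R).

Definition cexp (z : C) : C :=
  (expR (complex.Re z) * cos (complex.Im z) +i*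
   (expR (complex.Re z) * sin (complex.Im z)))%C.

Lemma cexpD z w : cexp (z + w) = cexp z * cexp w.
Proof.
case: z w => a b [c d]; apply/eqP; rewrite eq_complex /=.
by rewrite expRD sinD cosD; apply/andP; split; apply/eqP; ring.
Qed.

Lemma modulus_cexp z : modulus (cexp z) = expR (complex.Re z).
Proof.
case: z => a b; rewrite /modulus /=.
rewrite !exprMn -mulrDr cos2Dsin2 mulr1 sqrtr_sqr ger0_norm// expR_ge0.
Qed.

Lemma is_derive_realP (f : R -> R) (x l : R) : is_derive x 1 f l ->
  forall e : R, 0 < e -> exists2 del, 0 < del &
    forall h, `|h| < del -> `|f (h + x) - f x - l * h| <= e * `|h|.
Proof.
move=> /is_deriveP H e /H /nbhs_ballP[del /= del0 dP]; exists del => // h hd.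
by rewrite (mulrC l); apply: dP; rewrite -ball_normE /ball_/= sub0r normrN.
Qed.

(** By the addition formula it suffices to expand at 0, where the real
    expansions of exp, cos and sin apply. *)
Lemma is_derive_cexp (z : C) : is_derive z 1 cexp (cexp z).
Proof.
have near0 (e : R) : 0 < e <= 1 -> exists2 del, 0 < del & forall a b : R,
    `|a| < del -> `|b| < del ->
    `|expR a * cos b - 1 - a| + `|expR a * sin b - b|
      <= 8 * e * Num.max `|a| `|b|.
  move=> /andP[e0 e1].
  have [d1 d10 exp1] := is_derive_realP (is_derive_expR (0 : R)) e0.
  have [d2 d20 cos1] := is_derive_realP (is_derive_cos (0 : R)) e0.
  have [d3 d30 sin1] := is_derive_realP (is_derive_sin (0 : R)) e0.
  exists (Num.min e (Num.min d1 (Num.min d2 d3)));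
    first by rewrite !lt_min e0 d10 d20.
  move=> a b; rewrite !lt_min => /and4P[ae a1 a2 a3] /and4P[be b1 b2 b3].
  have := exp1 a a1; have := cos1 b b2; have := sin1 b b3.
  rewrite !addr0 !expR0 sin0 cos0 !oppr0 !mul0r !mul1r !addr0 ?subr0 =>
    sb cb ea.
  have am : `|a| <= Num.max `|a| `|b| by rewrite le_max lexx.
  have bm : `|b| <= Num.max `|a| `|b| by rewrite le_max lexx orbT.
  set m := Num.max _ _ in am bm *.
  have a0 := normr_ge0 a; have b0 := normr_ge0 b.
  have h1 : `|expR a * cos b - 1 - a| <= 3 * e * m.
    rewrite (_ : _ - a = (expR a - 1 - a) * cos b + (1 + a) * (cos b - 1));
      last by ring.
    apply: le_trans (ler_normD _ _) _; rewrite !normrM.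
    have c1 : `|cos b| <= 1 by rewrite ler_norml cos_geN1 cos_le1.
    have a2' : `|1 + a| <= 2 by apply: le_trans (ler_normD _ _) _;
      rewrite normr1; lra.
    have := ler_pM (normr_ge0 _) (normr_ge0 _) ea c1.
    have := ler_pM (normr_ge0 _) (normr_ge0 _) a2' cb.
    by have := ler_wpM2l (ltW e0) am; have := ler_wpM2l (ltW e0) bm; lra.
  have h2 : `|expR a * sin b - b| <= 5 * e * m.
    rewrite (_ : _ - b = (expR a - 1) * sin b + (sin b - b)); last by ring.
    apply: le_trans (ler_normD _ _) _; rewrite !normrM.
    have s1 : `|sin b| <= 2 * `|b|.
      rewrite (_ : sin b = (sin b - b) + b); last by ring.
      apply: le_trans (ler_normD _ _) _.
      by have := ler_wpM2r b0 e1; lra.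
    have e2 : `|expR a - 1| <= 2 * e.
      rewrite (_ : _ - 1 = (expR a - 1 - a) + a); last by ring.
      apply: le_trans (ler_normD _ _) _.
      by have := ler_wpM2r a0 e1; lra.
    have := ler_pM (normr_ge0 _) (normr_ge0 _) e2 s1.
    by have := ler_wpM2l (ltW e0) bm; lra.
  by lra.
apply/is_derive_modulusP => e e0.
have E0 : 0 < expR (complex.Re z) by exact: expR_gt0.
pose e' := Num.min 1 (e / expR (complex.Re z) / 8).
have e'0 : 0 < e' <= 1 by rewrite lt_min ltr01 !divr_gt0//= ge_min lexx.
have e'e : 8 * e' * expR (complex.Re z) <= e.
  have : e' <= e / expR (complex.Re z) / 8 by rewrite ge_min lexx orbT.
  by rewrite ler_pdivlMr// ler_pdivlMr// (mulrC e').
have [del del0 dP] := near0 _ e'0; exists del => // h hd.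
rewrite cexpD (mulrC (cexp h)).
rewrite (_ : _ - _ - _ = cexp z * (cexp h - 1 - h)); last first.
  by rewrite !mulrBr mulr1 (mulrC h).
rewrite modulusM modulus_cexp.
have ah := le_Re_modulus h; have bh := le_Im_modulus h.
have {dP} := dP (complex.Re h) (complex.Im h) (le_lt_trans ah hd)
  (le_lt_trans bh hd).
set m := Num.max _ _ => dP.
have mh : m <= modulus h by rewrite ge_max ah.
apply: le_trans (ler_wpM2r (modulus_ge0 h) e'e).
rewrite [leRHS]mulrAC mulrC ler_wpM2r// ?expR_ge0//.
apply: le_trans (modulus_le_ReIm _) _.
apply: le_trans (le_trans dP _); last first.
  by rewrite ler_wpM2l// mulr_ge0//; case/andP: e'0 => /ltW.
by case: (h) => a b; rewrite /= !subr0.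
Qed.
End ComplexExponential.

(** * The Cauchy estimate *)

Section CauchyEstimate.
Context {R : realType}.
Notation C := (Cplx R).

Lemma affine_approx_slices (P : R -> R -> R) s t p q :
  affine_approx P s t p q ->
  {for s, continuous (P^~ t)} /\ {for t, continuous (P s)}.
Proof.
move=> /(_ 1 ltr01)[del del0 H].
suff key (u : R -> R) (x k : R) :
    (forall y, `|y - x| <= del -> `|u y - u x - k * (y - x)| <= 1 * `|y - x|) ->
    {for x, continuous u}.
  split; [apply: (@key _ _ p) => y yd | apply: (@key _ _ q) => y yd].
  - have := H y t yd; rewrite subrr normr0 => /(_ (ltW del0)).
    by rewrite mulr0 subr0 addr0.
  - have := H s y _ yd; rewrite subrr normr0 => /(_ (ltW del0)).
    by rewrite mulr0 subr0 add0r.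
move=> ku; apply/cvgrPdist_le => e e0.
have k0 : 0 < 1 + `|k| by rewrite ltr_pwDl.
have d0 : 0 < Num.min del (e / (1 + `|k|)) by rewrite lt_min del0 divr_gt0.
near=> y; rewrite distrC.
have : `|y - x| <= Num.min del (e / (1 + `|k|)).
  by rewrite distrC; near: y; exact: cvgr_dist_le.
rewrite le_min => /andP[/ku yd ye].
rewrite (_ : u y - u x = (u y - u x - k * (y - x)) + k * (y - x)); last by ring.
apply: le_trans (ler_normD _ _) _; rewrite normrM.
apply: le_trans (lerD yd (lexx _)) _.
by rewrite -mulrDl mulrC -ler_pdivlMr.
Unshelve. all: by end_near. Qed.

(** The Cauchy-Riemann equations say that Im K ds + Re K dt, the real part of
    -i K dz, is closed; the two sides of closedness are read off the same
    complex expansion of [K]. *)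
Lemma holomorphic_affine_approx (K : C -> C) (s t p q : R) :
  is_derive ((s +i* t)%C : C) 1 K (p +i* q)%C ->
  affine_approx (fun s t => complex.Im (K (s +i* t)%C)) s t q p /\
  affine_approx (fun s t => complex.Re (K (s +i* t)%C)) s t p (- q).
Proof.
move=> /is_derive_modulusP H.
suff key e : 0 < e -> exists2 del, 0 < del &
    forall s' t', `|s' - s| <= del -> `|t' - t| <= del ->
      modulus (K (s' +i* t')%C - K (s +i* t)%C -
        ((s' - s) +i* (t' - t))%C * (p +i* q)%C) <= e * (`|s' - s| + `|t' - t|).
  split=> e /key[del del0 {}H]; exists del => // s' t' s'd t'd;
    apply: le_trans (H _ _ s'd t'd).
    apply: le_trans (le_Im_modulus _); rewrite le_eqVlt; apply/orP; left.
    apply/eqP; congr (`|_|); case: (K _) => a b; case: (K _) => c d /=; ring.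
  apply: le_trans (le_Re_modulus _); rewrite le_eqVlt; apply/orP; left.
  apply/eqP; congr (`|_|); case: (K _) => a b; case: (K _) => c d /=; ring.
move=> e0; have [del del0 {}H] := H e e0.
exists (del / 3); first by rewrite divr_gt0.
move=> s' t' s'd t'd.
have hm := modulus_le_ReIm (((s' - s) +i* (t' - t))%C : C).
have := H ((s' - s) +i* (t' - t))%C; rewrite /= in hm.
have -> : ((s' - s) +i* (t' - t))%C + (s +i* t)%C = (s' +i* t')%C :> C.
  by apply/eqP; rewrite eq_complex /= !subrK !eqxx.
move=> {}H; apply: le_trans (H _) _; last by rewrite ler_wpM2l// ltW.
by apply: le_lt_trans hm _; lra.
Qed.

Lemma cexp_periodic (s : R) : cexp (s +i* (pi *+ 2))%C = cexp (s +i* 0)%C.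
Proof. by rewrite /cexp /= cos2pi sin2pi cos0 sin0. Qed.

Lemma cexp_neq0 (z : C) : cexp z != 0.
Proof. by rewrite -modulus_gt0 modulus_cexp expR_gt0. Qed.

(** Let K z = (g (e^z) - g 0) / e^z. The integral of Re K over a vertical
    segment of height 2 pi does not depend on its abscissa: the form of
    [holomorphic_affine_approx] is closed, and the two horizontal sides of a
    rectangle of height 2 pi cancel by periodicity. At the abscissa ln r the
    integral is at most 2 pi (2 M / r) in absolute value, and at abscissas
    tending to -oo it tends to 2 pi Re g'(0). *)
Lemma Re_cauchy_estimate (g : C -> C) (r M : R) : 0 < r < 1 ->
  (forall z, modulus z < 1 -> derivable g z 1) ->
  (forall z, modulus z <= r -> modulus (g z) <= M) ->
  `|complex.Re (derive1 g 0)| <= 2 * M / r.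
Proof.
move=> /andP[r0 r1] dg gM.
pose K (z : C) : C := (g (cexp z) - g 0) / cexp z.
have dK (z : C) : complex.Re z < 0 -> derivable K z 1.
  move=> z0; apply: derivableM.
    apply: derivableB; last exact: derivable_cst.
    apply/derivable1_diffP/differentiable_comp.
      by apply/derivable1_diffP; have [] := is_derive_cexp z.
    apply/derivable1_diffP/dg; rewrite modulus_cexp.
    by rewrite -expR0 ltr_expR.
  by apply: derivableV; [exact: cexp_neq0|have [] := is_derive_cexp z].
pose P (s t : R) := complex.Im (K (s +i* t)%C).
pose Q (s t : R) := complex.Re (K (s +i* t)%C).
have PQ s t : s < 0 ->
    exists p q r, affine_approx P s t p q /\ affine_approx Q s t q r.
  move=> s0; have := derivableP (dK (s +i* t)%C s0).
  case: ('D_1 K _) => p q dKst.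
  by exists q, p, (- q); exact: holomorphic_affine_approx.
set dg0 := derive1 g 0.
apply/ler_addgt0Pr => e e0.
have : is_derive (0 : C) 1 g dg0.
  by rewrite /dg0 derive1E; apply: derivableP; apply: dg; rewrite modulus0.
move=> /is_derive_modulusP/(_ e e0)[del del0 dg0P].
pose s1 := ln r; have s10 : s1 < 0 by rewrite ln_lt0// r0.
(* An abscissa below [s1] with e^s0 < del, where [g] is close to its
   linear part. *)
pose s0 := Num.min s1 (ln del) - 1.
have s0s1 : s0 < s1.
  by rewrite /s0 ltrBlDr (@le_lt_trans _ _ s1) ?ge_min ?lexx// ltrDl.
have s0del : expR s0 < del.
  rewrite -[ltRHS]lnK// ltr_expR /s0 ltrBlDr.
  by rewrite (@le_lt_trans _ _ (ln del)) ?ge_min ?lexx ?orbT// ltrDl.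
have pi2 : 0 < pi *+ 2 :> R by rewrite mulrn_wgt0// pi_gt0.
have exA t : exists F : R -> R, forall s, s0 - 1 < s < s1 / 2 ->
    is_derive s 1 F (P s t).
  apply: primitive_exists; first by lra.
  move=> s /andP[_ ss1]; have [|p [q [_ [+ _]]]] := PQ s t; first by lra.
  by move=> /affine_approx_slices[].
have exB s : s < 0 -> exists F : R -> R, forall t, -1 < t < pi *+ 2 + 1 ->
    is_derive t 1 F (Q s t).
  move=> sneg; apply: primitive_exists; first by lra.
  move=> t _; have [p [q [r' [_ ]]]] := PQ s t sneg.
  by move=> /affine_approx_slices[].
have /choice[A dA] := exA.
have /choice[B dB] : forall s, exists F : R -> R, s < 0 ->
  forall t, -1 < t < pi *+ 2 + 1 ->
    is_derive t 1 F (Q s t).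
  move=> s; have [/exB[F ?]|s_ge0] := ltP s 0; first by exists F.
  by exists id.
have w0 : 0 < s1 - s0 by lra.
have := @circ_eq0 R P Q A B s0 0 (s1 - s0) (pi *+ 2) w0 pi2.
rewrite add0r (addrC s0) subrK => circ0.
have {circ0} : circ A B s0 s1 0 (pi *+ 2) = 0.
  apply: circ0.
  - by move=> s t ss _; apply: dA; lra.
  - by move=> s t ss tt; apply: dB; lra.
  - by move=> s t ss _; apply: PQ; lra.
(* The horizontal sides cancel: the forms agree at heights 0 and 2 pi. *)
have Aper : (A (pi *+ 2) s1 - A 0 s1) - (A (pi *+ 2) s0 - A 0 s0) = 0.
  apply/normr0_eq0/le_anti; rewrite normr_ge0 andbT.
  rewrite -[leRHS](mul0r (s1 - s0)).
  apply: (@increment_le _ (fun s => A (pi *+ 2) s - A 0 s)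
     (fun s => P s (pi *+ 2) - P s 0)); first exact: ltW.
    by move=> x xs; apply: is_deriveB; apply: dA; lra.
  by move=> x _; rewrite /P /K cexp_periodic subrr normr0.
rewrite /circ => circ0.
have B1 : `|B s1 (pi *+ 2) - B s1 0| <= 2 * M / r * (pi *+ 2).
  rewrite -[X in _ * X]subr0.
  apply: (@increment_le _ (B s1) (Q s1)); first exact: ltW.
    by move=> t tt; apply: dB => //; lra.
  move=> t _; apply: le_trans (le_Re_modulus _) _.
  rewrite /K modulusM modulusV modulus_cexp /= lnK//.
  rewrite ler_wpM2r ?invr_ge0 ?(ltW r0)//.
  apply: le_trans (le_modulusB _ _) _; rewrite mulr2n mulrDl mul1r.
  by rewrite lerD// gM// ?modulus0 ?(ltW r0)// modulus_cexp/= lnK.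
have B0 : `|B s0 (pi *+ 2) - B s0 0 - complex.Re dg0 * (pi *+ 2)| <= e *
  (pi *+ 2).
  rewrite -[X in _ <= _ * X]subr0
    (_ : _ - _ = (B s0 (pi *+ 2) - complex.Re dg0 * (pi *+ 2)) -
    (B s0 0 - complex.Re dg0 * 0)); last by ring.
  apply: (@increment_le _ (fun t => B s0 t - complex.Re dg0 * t)
    (fun t => Q s0 t - complex.Re dg0)); first exact: ltW.
    move=> t tt; apply: is_deriveB; first by apply: dB; lra.
    apply: (is_derive_eq (is_deriveZ _ _)).
    by rewrite /GRing.scale/= mulr1.
  move=> t _; have := dg0P (cexp (s0 +i* t)%C);
    rewrite modulus_cexp addr0 => /(_ s0del).
  rewrite -[X in modulus X](_ : (K (s0 +i* t)%C - dg0) * cexp (s0 +i* t)%C = _);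
    last first.
    by rewrite mulrBl /K divfK ?cexp_neq0// (mulrC dg0).
  rewrite modulusM modulus_cexp ler_pM2r ?expR_gt0//; apply: le_trans.
  apply: le_trans (le_Re_modulus _); rewrite /Q.
  by case: (K _) => ? ?; case: (dg0).
have BB : B s0 (pi *+ 2) - B s0 0 = B s1 (pi *+ 2) - B s1 0 by lra.
rewrite BB in B0.
rewrite -(ler_pM2r pi2).
have -> : `|complex.Re dg0| * (pi *+ 2) =
    `|(B s1 (pi *+ 2) - B s1 0) -
      (B s1 (pi *+ 2) - B s1 0 - complex.Re dg0 * (pi *+ 2))|.
  by rewrite opprB addrC subrK normrM (ger0_norm (ltW pi2)).
by apply: le_trans (ler_normB _ _) _; rewrite mulrDl lerD.
Qed.

(** Multiplication of [g] by i exchanges, up to sign, the imaginary part of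
    the derivative for the real part. *)
Lemma cauchy_estimate (g : C -> C) (r M : R) : 0 < r < 1 ->
  (forall z, modulus z < 1 -> derivable g z 1) ->
  (forall z, modulus z <= r -> modulus (g z) <= M) ->
  modulus (derive1 g 0) <= 4 * M / r.
Proof.
move=> r01 dg gM; have hRe := Re_cauchy_estimate r01 dg gM.
have idg z : modulus z < 1 -> derivable (('i%C : C) \*: g) z 1.
  by move=> z1; apply: derivableZ; exact: dg.
have := Re_cauchy_estimate r01 idg (M := M).
have -> : derive1 (('i%C : C) \*: g) 0 = 'i%C * derive1 g 0.
  rewrite !derive1E deriveZ//; apply: dg; by rewrite modulus0.
move=> hIm.
have {}hIm : `|complex.Im (derive1 g 0)| <= 2 * M / r.
  rewrite -normrN -ReiNIm mulrC; apply: hIm => z zr.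
  rewrite /= /GRing.scale/= modulusM (_ : modulus _ = 1) ?mul1r ?gM//.
  by rewrite /modulus /= expr0n/= add0r expr1n sqrtr1.
apply: le_trans (modulus_le_ReIm _) _; apply: le_trans (lerD hRe hIm) _.
by rewrite -!mulrA; lra.
Qed.
End CauchyEstimate.

(** * Sequences and compact sets of complex numbers and row vectors *)

Section Topology.
Context {R : realType}.
Notation C := (Cplx R).

Lemma cvg_subsequence (s : nat -> nat) :
  {homo s : i j / (i < j)%N} -> s @ \oo --> \oo.
Proof.
move=> s_incr; have le_s k : (k <= s k)%N.
  by elim: k => // k IH; apply: leq_ltn_trans (s_incr _ _ (ltnSn k)).
move=> U [N _ NU]; exists N => // k /= Nk.
by apply: NU => /=; apply: leq_trans (le_s k).
Qed.

Lemma subsequence_cvg (T : topologicalType) (u : nat -> T) (s : nat -> nat)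
    (l : T) :
  {homo s : i j / (i < j)%N} -> u @ \oo --> l -> (u \o s) @ \oo --> l.
Proof. by move=> /cvg_subsequence sc ul; apply: cvg_comp sc ul. Qed.

Lemma not_near_sequence (T : pseudoMetricType C) (a : T) (P : set T) :
  ~ (\forall x \near a, P x) ->
  exists2 u : nat -> T, u @ \oo --> a & forall k, ~ P (u k).
Proof.
move=> nP.
have /choice[u uP] : forall k : nat, exists x : T,
    ball a (((k.+1%:R : R)^-1)%:C)%C x /\ ~ P x.
  move=> k; apply: contrapT => /forallNP H; apply: nP.
  apply/nbhs_ballP; exists (((k.+1%:R : R)^-1)%:C)%C => /=;
    first by rewrite ltcR.
  by move=> x ax; apply: contrapT => nPx; exact: (H x).
exists u; last by move=> k; case: (uP k).
apply/cvg_ballP => e /posC_real[r r0 ->].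
exists (Num.bound r^-1) => // k /= rk; have [+ _] := uP k.
apply: le_ball; rewrite lecR invf_ple ?posrE ?ltr0Sn//.
apply/ltW/(lt_le_trans (archi_boundP _)); first by rewrite invr_ge0 ltW.
by rewrite ler_nat (leq_trans rk).
Qed.

Lemma cvg_modulusP (T : Type) (F : set_system T) {FF : Filter F}
    (u : T -> C) (l : C) :
  u @ F --> l <-> forall e : R, 0 < e ->
    \forall x \near F, modulus (u x - l) <= e.
Proof.
split.
  move=> /cvgrPdist_le ul e e0; have := ul (e%:C)%C; rewrite ltcR => /(_ e0).
  by apply: filterS => x; rewrite distrC le_normC.
move=> ul; apply/cvgrPdist_le => e /posC_real[r /ul + ->].
by apply: filterS => x; rewrite distrC le_normC.
Qed.

Lemma continuous_real_complex : continuous (fun x : R => (x%:C)%C : C).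
Proof.
move=> x; apply/cvg_modulusP => e e0; near=> y.
by rewrite -rmorphB modulus_real distrC; near: y; exact: cvgr_dist_le.
Unshelve. all: by end_near. Qed.

Lemma continuous_modulus : continuous (@modulus R : C -> R).
Proof.
move=> z; apply/(@cvgrPdist_le _ _ _ _ (nbhs_filter (z : C))) => e e0.
have /cvg_modulusP/(_ e e0) : (w : C) @[w --> z] --> z by exact: cvg_id.
apply: filterS => w; apply: le_trans; rewrite ler_norml; apply/andP; split.
  by rewrite lerNl opprB lerBlDr (le_trans _ (le_modulusD _ _))// subrK.
by rewrite lerBlDr -(modulusN (w - z)) (le_trans _ (le_modulusD _ _))// opprB
  subrK.
Qed.

(** The disc is a closed part of the image of a square of R x R. *)
Lemma compact_closed_disc (c : C) (r : R) :
  compact [set z : C | modulus (z - c) <= r].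
Proof.
pose f (x : R * R) : C := (x.1%:C + 'i * x.2%:C)%C.
have fc : continuous f.
  have cc (u : R * R -> R) : continuous u ->
    continuous (fun x => (u x)%:C%C : C).
    by move=> uc x; apply: (@continuous_comp _ _ _ u (fun y : R => y%:C%C : C));
      [exact: uc|exact: continuous_real_complex].
  move=> x; apply: cvgD; first by apply: cc => y; exact: cvg_fst.
  by apply: cvgM; [exact: cvg_cst|apply: cc => y; exact: cvg_snd].
pose K : set (R * R) := `[complex.Re c - r, complex.Re c + r]%classic `*`
  `[complex.Im c - r, complex.Im c + r]%classic.
have cK : compact K by apply: compact_setX; exact: segment_compact.
apply: (@subclosed_compact _ _ (f @` K)).
- apply: (@preimage_closed _ _ (fun z : C => modulus (z - c)) [set x | x <= r]);
    last exact: closed_le.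
  move=> z _; apply: (@continuous_comp _ _ _ (fun z : C => z - c) (@modulus R));
    last exact: continuous_modulus.
  by apply: continuousB; [move=> ?; exact: cvg_id|exact: cst_continuous].
- by apply: continuous_compact => //; apply: continuous_subspaceT.
move=> z /= zr; exists (complex.Re z, complex.Im z);
  last by rewrite /f /= -complexE.
have := le_trans (le_Re_modulus (z - c)) zr.
have := le_trans (le_Im_modulus (z - c)) zr.
rewrite /K; case: z c {zr K cK} => a b [c d].
rewrite /= !ler_norml => /andP[? ?] /andP[? ?].
by split; rewrite /= in_itv/=; apply/andP; split; lra.
Qed.

Lemma bounded_subsequence (u : nat -> C) (M : R) :
  (forall k, modulus (u k) <= M) ->
  exists2 s : nat -> nat, {homo s : i j / (i < j)%N} &
    exists l : C, (u \o s) @ \oo --> l.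
Proof.
move=> uM.
have bnd (v : nat -> R) : (forall k, `|v k| <= M) -> bounded_fun v.
  move=> vM; exists M; split; first exact: num_real.
  by move=> x Mx k _; apply: le_trans (vM k) (ltW Mx).
have incr (s : nat -> nat) : increasing_seq s -> {homo s : i j / (i < j)%N}.
  by move=> /increasing_seqP H; apply: homo_ltn => //; exact: ltn_trans.
have [|f /incr fi /cvg_ex[a ua]] :=
  @bolzano_weierstrass _ (fun k => complex.Re (u k)).
  by apply: bnd => k; apply: le_trans (le_Re_modulus _) _.
have [|g /incr gi /cvg_ex[b ub]] :=
  @bolzano_weierstrass _ (fun k => complex.Im (u (f k))).
  by apply: bnd => k; apply: le_trans (le_Im_modulus _) _.
exists (f \o g); first by move=> i j ij; apply: fi; apply: gi.
exists (a +i* b)%C; rewrite [X in X @ _ --> _](_ : _ = (fun k =>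
  (complex.Re (u (f (g k))))%:C%C + 'i%C * (complex.Im (u (f (g k))))%:C%C));
    last first.
  by apply/funext => k /=; rewrite -complexE.
rewrite (complexE (a +i* b)%C); apply: cvgD.
  apply: (cvg_comp _ _ (subsequence_cvg gi ua)); exact: continuous_real_complex.
apply: cvgM; first exact: cvg_cst.
by apply: (cvg_comp _ _ ub); exact: continuous_real_complex.
Qed.

Section RowVectors.
Context {n : nat}.
Notation V := 'rV[C]_n.

Lemma nbhs_rowP (v : V) (U : set V) : nbhs v U <->
  exists2 e : R, 0 < e & forall w : V,
    (forall i, modulus (w ord0 i - v ord0 i) < e) -> U w.
Proof.
split.
  move=> /nbhs_ballP[e /= /posC_real[r r0 ->] eU]; exists r => // w wv;
    apply: eU.
  split=> [|i j]; first by rewrite ltcR.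
  by rewrite -ball_normE /ball_/= distrC lt_normC ord1.
move=> [e e0 eU]; apply/nbhs_ballP; exists (e%:C)%C => /=;
  first by rewrite ltcR.
move=> w [_ vw]; apply: eU => i.
by have := vw ord0 i; rewrite -ball_normE /ball_/= distrC lt_normC.
Qed.

Lemma cvg_rowP (T : Type) (F : set_system T) {FF : Filter F} (u : T -> V)
    (l : V) :
  u @ F --> l <-> forall i, (fun x => u x ord0 i) @ F --> l ord0 i.
Proof.
split=> [ul i|H].
  by apply: (@cvg_comp _ _ _ u (fun v : V => v ord0 i) _ _ _ ul);
    exact: coord_continuous.
move=> U /nbhs_rowP[e e0 eU].
have e2 : 0 < e / 2 by rewrite divr_gt0.
have : \forall x \near F, forall i, modulus (u x ord0 i - l ord0 i) <= e / 2.
  apply: filter_forall => i; have /cvg_modulusP := H i; exact.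
rewrite /nbhs/=; apply: filterS => x ux; apply: eU => i.
by apply: le_lt_trans (ux i) _; rewrite ltr_pdivrMr// mulr2n mulrDr mulr1 ltrDl.
Qed.

(** A small closed polydisc, as a product of compact discs. *)
Lemma compact_nbhs_in_open (D : set V) (z : V) : open D -> D z ->
  exists L : set V, [/\ compact L, L `<=` D & nbhs z L].
Proof.
move=> oD Dz; have /nbhs_rowP[e e0 eD] : nbhs z D by exact: open_nbhs_nbhs.
exists [set v : V | forall i, modulus (v ord0 i - z ord0 i) <= e / 2]; split.
- apply: (@rV_compact _ n
  (fun i => [set x : C | modulus (x - z ord0 i) <= e / 2])).
  by move=> i; exact: compact_closed_disc.
- move=> v vz; apply: eD => i; apply: le_lt_trans (vz i) _.
  by rewrite ltr_pdivrMr// mulr2n mulrDr mulr1 ltrDl.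
- apply/nbhs_rowP; exists (e / 2); first by rewrite divr_gt0.
  by move=> w wz i; exact/ltW.
Qed.

Lemma normr_row_le (v : V) (e : C) : 0 <= e ->
  (`|v| <= e) <-> (forall i, `|v ord0 i| <= e).
Proof.
move=> e0; pose e' := NngNum e0; rewrite -[`|v|]/(mx_norm v) mx_normE.
rewrite -[e]/(e'%:num) num_le; split.
  by move=> /bigmax_leP[_ H] i; have := H (ord0, i) isT; rewrite -num_le.
move=> H; apply/bigmax_leP; split; first by rewrite -num_le.
by move=> [i j] _; rewrite -num_le/= ord1.
Qed.

(** The norm of a row vector is the maximum of the moduli of its entries. *)
Lemma is_derive_rowP (f : C -> V) (x : C) (l : V) :
  is_derive x 1 f l <-> forall i, is_derive x 1 (fun y => f y ord0 i)
    (l ord0 i).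
Proof.
split.
  move=> /is_deriveP H i; apply/is_deriveP => e e0; have := H e e0.
  apply: filterS => h; have eh : 0 <= e * `|h| by rewrite mulr_ge0// ltW.
  by move=> /(normr_row_le _ eh)/(_ i); rewrite !mxE.
move=> H; apply/is_deriveP => e e0.
have : \forall h \near 0, forall i,
  `|f (h + x) ord0 i - f x ord0 i - h *: l ord0 i| <= e * `|h|.
  apply: (@filter_forall _ _ _ _ (nbhs_filter (0 : C))) => i.
  by have /is_deriveP := H i; exact.
apply: filterS => h hP; have eh : 0 <= e * `|h| by rewrite mulr_ge0// ltW.
by apply/(normr_row_le _ eh) => i; have := hP i; rewrite !mxE.
Qed.

Lemma uniform_cvgP (U : set C) (phi : nat -> C -> V) (psi : C -> V) :
  {uniform U, phi @ \oo --> psi} -> forall e : R, 0 < e ->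
  \forall k \near \oo, forall x, U x -> forall i,
    modulus (phi k x ord0 i - psi x ord0 i) < e.
Proof.
move=> H e e0.
pose P := [set h : C -> V | forall x, U x -> ball (psi x) (e%:C)%C (h x)].
have : nbhs (psi : {uniform` U -> V}) P.
  apply/uniform_nbhs; exists [set xy : V * V | ball xy.1 (e%:C)%C xy.2].
  have eC0 : 0 < (e%:C)%C :> C by rewrite ltcR.
  by split => //; rewrite -entourage_ballE; exists (e%:C)%C.
move=> /H HP; have : \forall k \near \oo, P (phi k) by exact: HP.
apply: filterS => k kP x Ux i; have [_] := kP x Ux => /(_ ord0 i).
by rewrite -ball_normE /ball_/= distrC lt_normC.
Qed.

End RowVectors.
End Topology.

(** * Families of analytic discs *)

Section Discs.
Context {R : realType} {n : nat}.
Notation C := (Cplx R).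
Notation V := 'rV[C]_n.
Implicit Types (D : set V) (z w X : V) (phi psi : C -> V).

Lemma is_derive_scale (c : C) (f : C -> V) (x : C) (l : V) :
  is_derive (c * x) 1 f l -> is_derive x 1 (fun y => f (c * y)) (c *: l).
Proof.
move=> /is_deriveP H; apply/is_deriveP => e e0.
have c0 : 0 < 1 + `|c| by rewrite ltr_pwDl.
have [del del0 dP] := (nbhs_modulusP _ _).1
  (H (e / (1 + `|c|)) (divr_gt0 e0 c0)).
have mc0 : 0 < 1 + modulus c by rewrite ltr_pwDl// modulus_ge0.
apply/nbhs_modulusP; exists (del / (1 + modulus c)); first by rewrite divr_gt0.
move=> h; rewrite subr0 ltr_pdivlMr// => hdel.
rewrite mulrDr scalerA (mulrC h).
apply: le_trans (dP (c * h) _) _.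
  rewrite subr0 modulusM mulrC; apply: le_lt_trans hdel.
  by rewrite ler_wpM2l ?modulus_ge0// lerDr.
rewrite normrM mulrA ler_wpM2r// mulrAC ler_pdivrMr// ler_wpM2l ?(ltW e0)//.
by rewrite lerDr.
Qed.

Lemma derivable_scale (c : C) phi (x : C) :
  derivable phi (c * x) 1 -> derivable (fun y => phi (c * y)) x 1.
Proof. by move=> /derivableP/is_derive_scale[]. Qed.

Lemma derivable_cvg phi (x : C) : derivable phi x 1 -> phi @ x --> phi x.
Proof. by move=> /derivable1_diffP/differentiable_continuous. Qed.

Lemma analytic_disc_derivable D phi (x : C) :
  analytic_disc D phi -> modulus x < 1 -> derivable phi x 1.
Proof. by move=> Dphi /unit_discE/Dphi[]. Qed.

Lemma analytic_disc_in D phi (x : C) :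
  analytic_disc D phi -> modulus x < 1 -> D (phi x).
Proof. by move=> Dphi /unit_discE/Dphi[]. Qed.

(** Compactness of the closed disc turns a condition that holds near each of
    its points into one that holds for all of them at once. *)
Lemma near_closed_disc (D : set V) (I : Type) (F : set_system I) {FF : Filter F}
    (G : I -> C -> V) (r : R) :
  (forall x, modulus x <= r ->
    \forall i \near filter_prod (nbhs (x : C)) F, modulus i.1 <= r ->
      D (G i.2 i.1)) ->
  \forall i \near F, forall x, modulus x <= r -> D (G i x).
Proof.
move=> H; have := @compact_closed_disc R 0 r.
move=> /compact_near_coveringP/near_covering_withinP.
move=> /(_ I F (fun i x => D (G i x)) FF) K.
have : \forall i \near F, [set x : C | modulus (x - 0) <= r] `<=`
  (fun x => D (G i x)).
  apply: K => x /=; rewrite subr0 => /H.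
  by apply: filterS => -[y i] /= yi; rewrite subr0.
by apply: filterS => i iP x xr; apply: iP; rewrite /= subr0.
Qed.

Lemma near_open D (T : Type) (F : set_system T) {FF : Filter F} (u : T -> V) z :
  open D -> D z -> u @ F --> z -> \forall x \near F, D (u x).
Proof.
move=> oD Dz uz; have zD : nbhs z D by exact: open_nbhs_nbhs.
exact: (uz _ zD).
Qed.

Lemma near_closed_disc_cvg (D : set V) (I : Type) (F : set_system I)
    {FF : Filter F}    (G : I -> C -> V) (phi : C -> V) (r : R) : open D ->
  (forall x, modulus x <= r -> D (phi x)) ->
  (forall x, modulus x <= r ->
    (fun i => G i.2 i.1) @ filter_prod (nbhs (x : C)) F --> phi x) ->
  \forall i \near F, forall x, modulus x <= r -> D (G i x).
Proof.
move=> oD Dphi Gphi; apply: near_closed_disc => x xr.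
by apply: filterS (near_open oD (Dphi x xr) (Gphi x xr)).
Qed.

(** Compactness controls images of closed discs of radius r < 1 only, so a
    perturbed disc has to be reparametrized by the factor r. *)
Lemma analytic_disc_shrink D phi (r : R) : 0 < r < 1 ->
  (forall x, modulus x < 1 -> derivable phi x 1) ->
  (forall x, modulus x <= r -> D (phi x)) ->
  analytic_disc D (fun x => phi ((r%:C)%C * x)).
Proof.
move=> /andP[r0 r1] dphi Dphi x /unit_discE x1.
have rx : modulus ((r%:C)%C * x) < r.
  by rewrite modulusM modulus_real ger0_norm ?(ltW r0)// gtr_pMr.
split; last by apply: Dphi; exact/ltW.
by apply: derivable_scale; apply: dphi; exact: lt_trans r1.
Qed.

Lemma constant_disc D z : D z -> analytic_disc D (fun=> z).
Proof. by move=> Dz x _; split => //; exact: derivable_cst. Qed.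

(** ** Any two points of a domain lie on an analytic disc *)

Section Reachability.
Variable D : set V.
Hypothesis oD : open D.

(** The point [w] is the value at a boundary point of the disc, where the
    value can be changed by a peak function, and [phi] is defined beyond the
    boundary, so that [w] becomes an interior value after rescaling. *)
Definition reachable z w := exists phi : C -> V,
  [/\ forall x, derivable phi x 1, phi 0 = z, phi 1 = w &
      forall x, modulus x <= 1 -> D (phi x)].

(** A function bounded by 1 on the closed unit disc, with value 1 at 1, which
    for large [N] is small on the disc away from 1. The factor [x] makes it
    vanish at 0. *)
Definition peak (N : nat) (x : C) : C := x * ((1 + x) / 2) ^+ N.

Lemma modulus_peak_le N (x : C) : modulus x <= 1 -> modulus (peak N x) <= 1.
Proof.
move=> x1; rewrite /peak modulusM mulr_ile1 ?modulus_ge0// modulusX.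
rewrite exprn_ile1 ?modulus_ge0// modulusM modulusV modulus2.
rewrite ler_pdivrMr// mul1r (le_trans (le_modulusD _ _))// modulus1.
by rewrite -[leRHS]/(1 + 1) lerD2l.
Qed.

Lemma half_sum_lt1 (x : C) : modulus x <= 1 -> x != 1 ->
  modulus ((1 + x) / 2) < 1.
Proof.
move=> x1 xN1; rewrite modulusM modulusV modulus2 ltr_pdivrMr// mul1r.
case: x x1 xN1 => a b; rewrite eq_complex /modulus /= => ab1 xN1.
have {}ab1 : a ^+ 2 + b ^+ 2 <= 1.
  rewrite -[leLHS]sqr_sqrtr ?addr_ge0 ?sqr_ge0// expr_le1// ?sqrtr_ge0//.
have b2 := sqr_ge0 b; have a2 := sqr_ge0 a.
have a1 : a < 1.
  rewrite ltNge; apply: contra xN1 => a1.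
  have a1' : a = 1 by nra.
  by rewrite a1' eqxx/= -sqrf_eq0; apply/eqP; nra.
rewrite add0r -(ltr_pXn2r (ltn0Sn 1)) ?nnegrE ?sqrtr_ge0//.
by rewrite sqr_sqrtr ?addr_ge0 ?sqr_ge0//; nra.
Qed.

Lemma cvg_peak (x : C) : modulus x <= 1 -> x != 1 ->
  (fun i => peak i.2 i.1) @ filter_prod (nbhs x) \oo --> (0 : C).
Proof.
move=> x1 xN1; apply/cvg_modulusP => e e0.
have q1 := half_sum_lt1 x1 xN1.
set q0 := modulus _ in q1; pose q := (q0 + 1) / 2.
have [q0q ql1 q_ge0] : [/\ q0 < q, q < 1 & 0 <= q].
  by have := modulus_ge0 ((1 + x) / 2); rewrite -/q0 /q; split; lra.
have nearx : \forall y \near x, modulus ((1 + y) / 2) <= q /\ modulus y <= 2.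
  apply/nbhs_modulusP; exists (Num.min 1 (q - q0));
    first by rewrite lt_min ltr01 subr_gt0.
  move=> y; rewrite lt_min => /andP[y1 yq]; split.
    rewrite (_ : (1 + y) / 2 = (1 + x) / 2 + (y - x) / 2); last by field.
    apply: le_trans (le_modulusD _ _) _;
      rewrite -/q0 modulusM modulusV modulus2.
    by have := modulus_ge0 (y - x); lra.
  rewrite -(subrK x y); apply: le_trans (le_modulusD _ _) _; lra.
have nearN : \forall N \near \oo, q ^+ N <= e / 2.
  have := @cvg_expr R q; rewrite ger0_norm// =>
    /(_ ql1) /cvgrPdist_le/(_ (e / 2)).
  rewrite divr_gt0// => /(_ isT); apply: filterS => N.
  by rewrite sub0r normrN ger0_norm// exprn_ge0.
exists ([set y | modulus ((1 + y) / 2) <= q /\ modulus y <= 2],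
  [set N | q ^+ N <= e / 2]) => //.
move=> [y N] /= [[yq y2] Nq]; rewrite subr0 /peak modulusM modulusX.
rewrite -[leRHS](@divfK _ 2)// mulrC; apply: ler_pM;
  rewrite ?exprn_ge0 ?modulus_ge0//.
by apply: le_trans Nq; rewrite lerXn2r// nnegrE modulus_ge0.
Qed.

Lemma derivable_mul (f g : C -> C) (x : C) : derivable f x 1 ->
  derivable g x 1 -> derivable (fun y => f y * g y) x 1.
Proof. by move=> df dg; exact: (derivableM df dg). Qed.

Lemma derivable_peak N (x : C) : derivable (peak N) x 1.
Proof.
pose h (x : C) : C := (1 + x) / 2.
have dh : derivable h x 1.
  apply: derivableM; last exact: derivable_cst.
  by apply: derivableD; [exact: derivable_cst|exact: derivable_id].
have dhN : derivable (fun y => h y ^+ N) x 1.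
  elim: N => [|N IH]; first by under eq_fun do rewrite expr0;
    exact: derivable_cst.
  by under eq_fun do rewrite exprS; exact: (derivable_mul dh IH).
have did : derivable (fun y : C => y) x 1 by exact: derivable_id.
exact: (derivable_mul did dhN).
Qed.

(** The disc [phi + peak N *: (w' - w)] ends at [w']. Near 1 its values stay
    in the polydisc about [w], because |peak N| <= 1 there, and away from 1
    they are close to those of [phi] if [N] is large. *)
Lemma reachable_step z w w' (e : R) : 0 < e ->
  (forall v : V, (forall i, modulus (v ord0 i - w ord0 i) < e) -> D v) ->
  (forall i, modulus (w' ord0 i - w ord0 i) < e / 2) ->
  reachable z w -> reachable z w'.
Proof.
move=> e0 eD ww' [phi [dphi phi0 phi1 Dphi]].
have : \forall N \near \oo, forall x, modulus x <= 1 ->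
    D (phi x + peak N x *: (w' - w)).
  apply: near_closed_disc => x x1.
  have [->|xN1] := eqVneq x 1.
    have : \forall y \near (1 : C), forall i,
      modulus (phi y ord0 i - w ord0 i) <= e / 2.
      apply: (@filter_forall _ _ _ _ (nbhs_filter (1 : C))) => i.
      have /cvg_rowP/(_ i)/cvg_modulusP := derivable_cvg (dphi 1).
      by rewrite phi1; apply; rewrite divr_gt0.
    exists ([set y | forall i, modulus (phi y ord0 i - w ord0 i) <= e / 2],
      setT) => /=.
      by split => //; exact: filterT.
    move=> [y N] /= [yP _] y1; apply: eD => i; rewrite !mxE addrAC.
    apply: le_lt_trans (le_modulusD _ _) _.
    rewrite [ltRHS](splitr e) ler_ltD// modulusM.
    apply: le_lt_trans (ww' i); rewrite ler_piMl ?modulus_ge0//.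
    exact: modulus_peak_le.
  have : (fun i => phi i.1 + peak i.2 i.1 *: (w' - w)) @
      filter_prod (nbhs x) \oo --> phi x + 0 *: (w' - w).
    apply: cvgD.
      apply: (@cvg_comp _ _ _ fst phi); first exact: cvg_fst.
      exact: derivable_cvg.
    by apply: cvgZr_tmp; exact: cvg_peak.
  rewrite scale0r addr0.
  by move=> /(near_open oD (Dphi x x1)); apply: filterS.
move=> [N _ /(_ N (leqnn N)) NP]; exists
  (fun x => phi x + peak N x *: (w' - w)); split.
- move=> x; apply: derivableD => //.
  apply/derivable1_diffP;
    apply: (@differentiable_comp _ _ _ _ (peak N) (fun c : C => c *: (w' - w))).
    by apply/derivable1_diffP; exact: derivable_peak.
  by apply: differentiableZl.
- by rewrite /peak mul0r scale0r addr0.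
- rewrite /peak mul1r -[1 + 1]/(2%:R) divff ?pnatr_eq0// expr1n scale1r phi1.
  by rewrite addrC subrK.
- exact: NP.
Qed.

(** By [reachable_step] the set of the points reachable from [z] is open and
    relatively closed in [D]. *)
Lemma connected_reachable z w : connected D -> D z -> D w -> reachable z w.
Proof.
move=> cD Dz Dw; pose B := [set v | D v /\ reachable z v].
suff BD : B = D by have := Dw; rewrite -BD => -[].
apply: cD.
- exists z; split => //; exists (fun=> z); split => // x; exact: derivable_cst.
- exists B; last by apply/seteqP; split => [v [? ?]|v [_ []]].
  rewrite openE => v [Dv zv]; have /nbhs_rowP[e e0 eD] : nbhs v D
    by exact: open_nbhs_nbhs.
  apply/nbhs_rowP; exists (e / 2); first by rewrite divr_gt0.
  move=> v' vv'; split; last exact: (reachable_step e0 eD vv' zv).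
  apply: eD => i; apply: lt_trans (vv' i) _.
  by rewrite ltr_pdivrMr// mulr2n mulrDr mulr1 ltrDl.
exists (closure B); first exact: closed_closure.
apply/seteqP; split => [v Bv|v [Dv clBv]].
  by split; [case: Bv|exact: subset_closure].
have /nbhs_rowP[e e0 eD] : nbhs v D by exact: open_nbhs_nbhs.
have e4 : 0 < e / 2 / 2 by rewrite !divr_gt0.
have /clBv[v' [[Dv' zv'] vv']] : nbhs v
  [set v' : V | forall i, modulus (v' ord0 i - v ord0 i) < e / 2 / 2].
  by apply/nbhs_rowP; exists (e / 2 / 2).
split => //; apply: (@reachable_step z v' v (e / 2)) => //.
- by rewrite divr_gt0.
- move=> u uv'; apply: eD => i.
  rewrite -(subrK (v' ord0 i) (u ord0 i)) -addrA.
  apply: le_lt_trans (le_modulusD _ _) _.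
  by have := uv' i; have := vv' i; lra.
- by move=> i; rewrite -modulusN opprB; exact: vv'.
Qed.

(** The image of the closed unit disc is a compact part of [D], so a slightly
    larger disc is still mapped into [D]; rescaling it moves the point 1 into
    the open unit disc. *)
Lemma reachable_disc z w : reachable z w ->
  exists (alpha : C) phi, disc_through D z w alpha phi.
Proof.
move=> [phi [dphi phi0 phi1 Dphi]].
have : \forall c \near (1 : C), forall x, modulus x <= 1 -> D (phi (c * x)).
  apply: (@near_closed_disc_cvg D C (nbhs (1 : C)) _ (fun c x => phi (c * x))
    phi) => // x x1.
  have cx : (fun i : C * C => i.2 * i.1) @ filter_prod (nbhs x) (nbhs (1 : C))
    --> x.
    by rewrite -[X in _ --> X]mul1r; apply: cvgM;
      [exact: cvg_snd|exact: cvg_fst].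
  exact: (@cvg_comp _ _ _ (fun i : C * C => i.2 * i.1) phi _ _ _ cx
    (derivable_cvg (dphi x))).
move=> /nbhs_modulusP[e e0 eP].
pose rho : C := ((1 + e / 2)%:C)%C.
have rho0 : 0 < 1 + e / 2 by rewrite addr_gt0// divr_gt0.
have rhoN0 : rho != 0 by rewrite -modulus_gt0 modulus_real normr_gt0 gt_eqF.
exists rho^-1, (fun x => phi (rho * x)); split.
- apply/unit_discE; rewrite modulusV modulus_real gtr0_norm// invf_lt1//.
  by rewrite ltrDl divr_gt0.
- move=> x /unit_discE x1; split; first exact: derivable_scale.
  apply: eP; last exact: ltW.
  have -> : rho - 1 = ((e / 2)%:C)%C.
    by rewrite /rho rmorphD addrC addKr.
  by rewrite modulus_real gtr0_norm ?divr_gt0// ltr_pdivrMr// mulr2n mulrDr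
    mulr1 ltrDl.
- by rewrite mulr0.
- by rewrite divff.
Qed.

End Reachability.
End Discs.

(** * Monotonicity of artanh and tanh *)

Section ArtanhMonotone.
Context {R : realType}.
Implicit Types x y t : R.

Lemma le_artanh x y : -1 < x -> x <= y -> y < 1 -> artanh x <= artanh y.
Proof.
move=> x1 xy y1; rewrite /artanh ler_pM2r ?invr_gt0// ler_ln ?posrE ?divr_gt0//;
  try lra.
by rewrite ler_pdivrMr ?subr_gt0; [|lra];
  rewrite mulrAC ler_pdivlMr ?subr_gt0//; nra.
Qed.

Lemma tanh_itv t : -1 < tanh t < 1.
Proof.
rewrite tanhE; have := expR_gt0 (2 * t); move: (expR _) => u u0.
by rewrite ltr_pdivlMr ?ltr_pdivrMr; [apply/andP; split|..]; lra.
Qed.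

Lemma lt_tanh_artanh x t : -1 < x < 1 -> artanh x < t -> x < tanh t.
Proof.
move=> /andP[x1 x2] xt; rewrite ltNge; apply/negP => tx.
have /andP[t1 _] := tanh_itv t.
by have := le_artanh t1 tx x2; rewrite tanhK leNgt xt.
Qed.

Lemma lt_artanh_tanh x t : -1 < x < 1 -> t < artanh x -> tanh t < x.
Proof.
move=> /andP[x1 x2] xt; rewrite ltNge; apply/negP => tx.
have /andP[_ t2] := tanh_itv t.
by have := le_artanh x1 tx t2; rewrite tanhK leNgt xt.
Qed.

Lemma artanh0 : artanh (0 : R) = 0.
Proof. by rewrite /artanh addr0 subr0 divr1 ln1 mul0r. Qed.

End ArtanhMonotone.

(** * Upper semicontinuity of ell and of the Lempert function *)

Section Lempert.
Context {R : realType} {n : nat}.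
Notation C := (Cplx R).
Notation V := 'rV[C]_n.
Implicit Types (D : set V) (z w X : V) (phi psi : C -> V).

Lemma is_derive_line (c : C) (v : V) (x : C) :
  is_derive x 1 (fun y => (y * c) *: v) (c *: v).
Proof.
apply/is_deriveP => e e0; apply/nbhs_modulusP; exists 1 => // h _.
rewrite -scalerBl mulrDl addrK scalerA subrr normr0 mulr_ge0//; exact: ltW.
Qed.

(** The disc [phi] shrunk by the factor [r], plus an affine function of the
    shrunk parameter. It sends 0 to [phi 0 + u] and [a / r] to [phi a + u + (a
    * c) *: v]. *)
Definition perturbed_disc phi (c : C) (r : R) (u v : V) (x : C) : V :=
  phi ((r%:C)%C * x) + u + (((r%:C)%C * x) * c) *: v.

(** [phi] maps the closed disc of radius [r] onto a compact subset of the open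
    set [D], which absorbs small perturbations. *)
Lemma near_perturbed_disc D phi (c : C) (r : R) :
  open D -> analytic_disc D phi -> 0 < r < 1 ->
  \forall p \near ((0 : V), (0 : V)),
    analytic_disc D (perturbed_disc phi c r p.1 p.2).
Proof.
move=> oD Dphi r01; have /andP[r0 r1] := r01.
have : \forall p \near ((0 : V), (0 : V)), forall x, modulus x <= r ->
    D (phi x + p.1 + (x * c) *: p.2).
  apply: (@near_closed_disc_cvg _ _ _ _ _ (nbhs_filter ((0 : V), (0 : V)))
    (fun p x => phi x + p.1 + (x * c) *: p.2) phi) => //.
    by move=> x xr; apply: analytic_disc_in Dphi _; exact: le_lt_trans r1.
  move=> x xr; have x1 : modulus x < 1 by exact: le_lt_trans r1.
  rewrite (_ : phi x = phi x + 0 + (x * c) *: 0);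
    last by rewrite scaler0 !addr0.
  apply: cvgD; first apply: cvgD.
  - apply: (@cvg_comp _ _ _ fst phi); first exact: cvg_fst.
    exact/derivable_cvg/(analytic_disc_derivable Dphi).
  - exact: (@cvg_comp _ _ _ snd fst _ _ _ cvg_snd cvg_fst).
  - apply: cvgZ; last exact: (@cvg_comp _ _ _ snd snd _ _ _ cvg_snd cvg_snd).
    by apply: cvgM; [exact: cvg_fst|exact: cvg_cst].
apply: filterS => -[u v] /= H.
apply: (analytic_disc_shrink (phi := fun x => phi x + u + (x * c) *: v)) => //.
move=> x x1; apply: derivableD; last by case: (is_derive_line c v x).
by apply: derivableD;
  [exact: analytic_disc_derivable Dphi _|exact: derivable_cst].
Qed.

Lemma ge0_inf (E : set R) : lbound E 0 -> 0 <= inf E.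
Proof.
move=> E0; have [->|/set0P E0'] := eqVneq E set0; first by rewrite inf0.
exact: lb_le_inf.
Qed.

Lemma ell_ge0 D z w : 0 <= ell D z w.
Proof. by apply: ge0_inf => _ [a _ <-]; exact: modulus_ge0. Qed.

Lemma ell_le D z w (a : C) phi : disc_through D z w a phi ->
  ell D z w <= modulus a.
Proof.
move=> zw; apply: ge_inf; last by exists a => //; exists phi.
by exists 0 => _ [b _ <-]; exact: modulus_ge0.
Qed.

Lemma ell_refl D z : D z -> ell D z z = 0.
Proof.
move=> Dz; apply/le_anti; rewrite ell_ge0 andbT -(@modulus0 R).
apply: (@ell_le _ _ _ _ (fun=> z)); split => //.
by apply/unit_discE; rewrite modulus0.
Qed.

Lemma ell_adherent D z w (e : R) : domain D -> D z -> D w -> 0 < e ->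
  exists (a : C) phi, disc_through D z w a phi /\ modulus a < ell D z w + e.
Proof.
move=> [oD cD _] Dz Dw e0.
have [a [phi zw]] := reachable_disc oD (connected_reachable oD cD Dz Dw).
have [|_ [b [psi zw' <-] bl]] := @inf_adherent R _ e e0 (_ : has_inf
    [set modulus a | a in [set a | exists phi, disc_through D z w a phi]]).
  split; first by exists (modulus a), a => //; exists phi.
  by exists 0 => _ [b _ <-]; exact: modulus_ge0.
by exists b, psi.
Qed.

Lemma ell_lt1 D z w : domain D -> D z -> D w -> ell D z w < 1.
Proof.
move=> [oD cD _] Dz Dw.
have [a [phi zw]] := reachable_disc oD (connected_reachable oD cD Dz Dw).
by apply: le_lt_trans (ell_le zw) _; case: zw => /unit_discE.
Qed.

(** Perturbing the value of a disc at its parameter [a] requires a division by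
    [a]. If [a] = 0 then [z] = [w], and the constant disc passes through both
    points with any other parameter. *)
Lemma ell_adherent_neq0 D z w (e : R) : domain D -> D z -> D w -> 0 < e ->
  exists (a : C) phi,
    [/\ disc_through D z w a phi, a != 0 & modulus a < ell D z w + e].
Proof.
move=> dD Dz Dw e0; have [a [phi [zw al]]] := ell_adherent dD Dz Dw e0.
have [a0|a0] := eqVneq a 0; last by exists a, phi.
have zwE : z = w by case: zw => _ _ <- <-; rewrite a0.
pose b := Num.min (e / 2) (1 / 2).
have b0 : 0 < b by rewrite lt_min !divr_gt0.
have be : b < e by rewrite gt_min ltr_pdivrMr// mulr2n mulrDr mulr1 ltrDl e0.
have b1 : b < 1 by rewrite gt_min [X in _ || X]ltr_pdivrMr// mul1r ltr1n orbT.
exists (b%:C)%C, (fun=> z); split.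
- by split => //; apply/unit_discE; rewrite modulus_real gtr0_norm.
- by rewrite -modulus_gt0 modulus_real normr_gt0 gt_eqF.
- by rewrite modulus_real gtr0_norm// (lt_le_trans be)// lerDr ell_ge0.
Qed.

Lemma shrink_radius (x c : R) : 0 <= x < 1 -> x < c ->
  exists2 r, 0 < r < 1 & x < r /\ x / r < c.
Proof.
move=> /andP[x0 x1] xc; have c0 : 0 < c by exact: le_lt_trans xc.
have [xc1 xc0] : x / c < 1 /\ 0 <= x / c.
  by rewrite ltr_pdivrMr// mul1r divr_ge0// ltW.
pose q := Num.max x (x / c).
have [q1 q0 xq xcq] : [/\ q < 1, 0 <= q, x <= q & x / c <= q].
  by rewrite /q gt_max x1 xc1 !le_max x0 !lexx orbT.
exists ((q + 1) / 2); first by lra.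
split; first by lra.
have q2 : 0 < (q + 1) / 2 by lra.
by rewrite ltr_pdivrMr// mulrC -ltr_pdivrMr//; lra.
Qed.

(** A disc that is nearly optimal for (z, w) is perturbed into discs through
    the nearby pairs of points, at the cost of dividing its parameter by some
    r close to 1. *)
Lemma ell_usc D z w (e : R) : domain D -> D z -> D w -> 0 < e ->
  \forall p \near (z, w), ell D p.1 p.2 <= ell D z w + e.
Proof.
move=> dD Dz Dw e0; have [a [phi [[a1 Dphi phi0 phia] a0 ae]]] :=
  ell_adherent_neq0 dD Dz Dw e0.
have [oD _ _] := dD.
have /unit_discE a1' := a1.
have [|r r01 [ar arc]] := shrink_radius _ ae; first by rewrite modulus_ge0 a1'.
have /andP[r0 r1] := r01.
have near_ab := near_perturbed_disc a^-1 oD Dphi r01.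
have cvg0 : (fun p : V * V => (p.1 - z, p.2 - w - (p.1 - z))) @ nbhs (z, w) -->
  ((0 : V), (0 : V)).
  have c1 : (fun p : V * V => p.1 - z) @ nbhs (z, w) --> (0 : V).
    by rewrite -(subrr z); apply: cvgB; [exact: cvg_fst|exact: cvg_cst].
  have c2 : (fun p : V * V => p.2 - w) @ nbhs (z, w) --> (0 : V).
    by rewrite -(subrr w); apply: cvgB; [exact: cvg_snd|exact: cvg_cst].
  have c3 : (fun p : V * V => p.2 - w - (p.1 - z)) @ nbhs (z, w) --> (0 : V).
    by rewrite -(subr0 0); exact: cvgB.
  exact: (cvg_pair c1 c3).
have : \forall p \near (z, w), analytic_disc D
  (perturbed_disc phi a^-1 r (p.1 - z) (p.2 - w - (p.1 - z))).
  exact: (cvg0 _ near_ab).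
apply: filterS => -[z' w'] /= Dp; apply: le_trans (ltW arc).
have -> : modulus a / r = modulus (a / (r%:C)%C).
  by rewrite modulusM modulusV modulus_real gtr0_norm.
have rN0 : (r%:C)%C != 0 :> C by rewrite -modulus_gt0 modulus_real normr_gt0
  gt_eqF.
apply: (ell_le (phi := perturbed_disc phi a^-1 r (z' - z) (w' - w - (z' - z))));
  split => //.
- apply/unit_discE; rewrite modulusM modulusV modulus_real gtr0_norm//.
  by rewrite ltr_pdivrMr// mul1r.
- by rewrite /perturbed_disc mulr0 mul0r scale0r addr0 phi0 addrC subrK.
- rewrite /perturbed_disc mulrCA divff// mulr1 divff// scale1r phia.
  by rewrite addrC (addrC w) addrA !subrK.
Qed.

Lemma lempert_ge0 D z w : ell D z w < 1 -> 0 <= lempert D z w.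
Proof.
move=> l1; rewrite -artanh0; by apply: le_artanh => //; exact: ell_ge0.
Qed.

Lemma lempert_refl D z : D z -> lempert D z z = 0.
Proof. by move=> Dz; rewrite /lempert ell_refl// artanh0. Qed.

Lemma ell_itv D z w : domain D -> D z -> D w -> -1 < ell D z w < 1.
Proof.
by move=> dD Dz Dw; rewrite ell_lt1// andbT (lt_le_trans _ (ell_ge0 D z w))
  ?ltrN10.
Qed.

(** A bound [ell <= tanh t] is equivalent to [lempert <= t], by monotonicity. *)
Lemma lempert_usc D z w (e : R) : domain D -> D z -> D w -> 0 < e ->
  \forall p \near (z, w), lempert D p.1 p.2 <= lempert D z w + e.
Proof.
move=> dD Dz Dw e0; pose c := tanh (lempert D z w + e).
have lc : ell D z w < c.
  by apply: lt_tanh_artanh; [exact: ell_itv|rewrite ltrDl].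
have := @ell_usc D z w (c - ell D z w) dD Dz Dw; rewrite subr_gt0 => /(_ lc).
apply: filterS => p; rewrite addrC subrK => pc.
rewrite -[leRHS]tanhK; apply: le_artanh => //.
  by rewrite (lt_le_trans _ (ell_ge0 _ _ _))// ltrN10.
by case/andP: (tanh_itv (lempert D z w + e)).
Qed.

End Lempert.

(** * Semicontinuity uniform in the number of steps *)

Section UniformSemicontinuity.
Context {R : realType} {T : topologicalType}.

(** At a point [a] some [F M a] is within eta / 2 of the infimum of the
    sequence. For the indices above [M] the neighborhood of [a] that serves
    for [F M] is good enough, by monotonicity, and there are finitely many
    others. *)
Lemma usc_uniformly_of_decreasing (A : set T) (F : nat -> T -> R) :
  (forall m, (0 < m)%N -> usc_on A (F m)) ->
  (forall m k a, (0 < m)%N -> A a -> F (m + k)%N a <= F m a) ->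
  (forall m a, A a -> 0 <= F m a) ->
  usc_on_uniformly A F.
Proof.
move=> Fusc Fdecr F0 a Aa eta eta0; have eta2 : 0 < eta / 2 by rewrite divr_gt0.
pose E := [set F m.+1 a | m in [set: nat]].
have [|_ [M _ <-] FM] := @inf_adherent _ E _ eta2.
  by split; [exists (F 1%N a), 0%N|exists 0 => _ [m _ <-]; exact: F0].
have near1 : \forall b \near within A (nbhs a), forall i : 'I_M.+1,
    F i.+1 b <= F i.+1 a + eta / 2.
  by apply: filter_forall => i; exact: Fusc.
have nearA : \forall b \near within A (nbhs a), A b.
  by rewrite near_withinE; exact: nearW.
apply: filterS2 near1 nearA => b bF Ab [//|m] _.
have [mM|Mm] := ltnP m M.+1.
  by apply: le_trans (bF (Ordinal mM)) _; rewrite lerD2l; lra.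
have Fma : inf E <= F m.+1 a.
  by apply: ge_inf; [exists 0 => _ [k _ <-]; exact: F0|exists m].
have -> : m.+1 = (M.+1 + (m - M))%N by rewrite addSn subnKC// ltnW.
apply: le_trans (Fdecr _ _ _ _ Ab) _ => //.
apply: le_trans (bF ord_max) _ => /=.
rewrite addSn subnKC 1?ltnW//; lra.
Qed.

End UniformSemicontinuity.

(** * Infima over chains *)

Section Chains.
Context {R : realType} {n : nat}.
Notation C := (Cplx R).
Notation V := 'rV[C]_n.
Variables (D : set V) (f : V -> V -> R).
Hypothesis f_ge0 : forall z w, D z -> D w -> 0 <= f z w.
Hypothesis f_refl : forall z, D z -> f z z = 0.

Lemma chain_sum_ge0 m z w y : chain D m z w y -> 0 <= chain_sum f m y.
Proof.
move=> [Dy _ _]; apply: sumr_ge0 => j _.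
by apply: f_ge0; apply: Dy => //; exact: ltnW.
Qed.

Lemma chain_inf_ge0 m z w : 0 <= chain_inf D f m z w.
Proof. by apply: ge0_inf => _ [y zw <-]; exact: chain_sum_ge0 zw. Qed.

Lemma chain_inf_le m z w y : chain D m z w y ->
  chain_inf D f m z w <= chain_sum f m y.
Proof.
move=> zw; apply: ge_inf; last by exists y.
by exists 0 => _ [x xzw <-]; exact: chain_sum_ge0 xzw.
Qed.

Lemma chain_inf_adherent m z w (e : R) : (0 < m)%N -> D z -> D w -> 0 < e ->
  exists2 y, chain D m z w y & chain_sum f m y < chain_inf D f m z w + e.
Proof.
move=> m0 Dz Dw e0; have [|_ [y zw <-] ye] :=
  @inf_adherent R _ e e0 (_ : has_inf
    [set chain_sum f m y | y in chain D m z w]).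
  split; last by exists 0 => _ [x xzw <-]; exact: chain_sum_ge0 xzw.
  exists (chain_sum f m (fun j => if j is 0%N then z else w)).
  exists (fun j => if j is 0%N then z else w) => //.
  by split => //; [case|case: m m0].
by exists y.
Qed.

(** A chain can be prolonged by resting at its last point. *)
Lemma chain_inf_decreasing m k z w : (0 < m)%N -> D z -> D w ->
  chain_inf D f (m + k) z w <= chain_inf D f m z w.
Proof.
move=> m0 Dz Dw; elim: k => [|k IH]; first by rewrite addn0.
apply: le_trans IH; rewrite addnS; move: (m + k)%N (ltn_addr k m0) => {}m {}m0.
apply/ler_addgt0Pr => e e0; have [y [Dy y0 ym] ye] :=
  chain_inf_adherent m0 Dz Dw e0.
apply/ltW/(le_lt_trans _ ye).
apply: le_trans (chain_inf_le (y := fun j => if (j <= m)%N then y j else w) _)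
  _.
  split => /= [j _||]; [|by rewrite y0|by rewrite ltnn].
  by case: ifP => // jm; exact: Dy.
rewrite /chain_sum big_ord_recr/= leqnn ltnn ym f_refl// addr0.
by rewrite le_eqVlt; apply/orP; left; apply/eqP/eq_bigr => i _;
  rewrite ltnW ltn_ord.
Qed.

Hypothesis f_usc : forall z w (e : R), D z -> D w -> 0 < e ->
  \forall p \near (z, w), f p.1 p.2 <= f z w + e.
Hypothesis oD : open D.

(** Of a nearly minimal chain only the two end points are moved; the interior
    points are kept. *)
Lemma chain_inf_usc m z w (e : R) : (0 < m)%N -> D z -> D w -> 0 < e ->
  \forall p \near (z, w), chain_inf D f m p.1 p.2 <= chain_inf D f m z w + e.
Proof.
move=> m0 Dz Dw e0; have e2 : 0 < e / 2 by rewrite divr_gt0.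
have [y [Dy y0 ym] ye] := chain_inf_adherent m0 Dz Dw e2.
pose Y (p : V * V) j := if j == 0%N then p.1 else if j == m then p.2 else y j.
have Ycvg j : (fun p => Y p j) @ nbhs (z, w) --> y j.
  rewrite /Y; case: eqP => [->|_]; first by rewrite y0; exact: cvg_fst.
  case: eqP => [->|_]; first by rewrite ym; exact: cvg_snd.
  exact: cvg_cst.
pose d := e / 2 / m%:R; have d0 : 0 < d by rewrite divr_gt0// ltr0n.
have near_steps : \forall p \near (z, w), forall j : 'I_m,
    f (Y p j) (Y p j.+1) <= f (y j) (y j.+1) + d.
  apply: (@filter_forall _ _ _ _ (nbhs_filter (z, w))) => j.
  have Yj : (fun p => (Y p j, Y p j.+1)) @ nbhs (z, w) --> (y j, y j.+1).
    exact: (cvg_pair (Ycvg j) (Ycvg j.+1)).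
  exact: (Yj _ (f_usc (Dy _ (ltnW (ltn_ord j))) (Dy _ (ltn_ord j)) d0)).
have Nz : nbhs z D by exact: open_nbhs_nbhs.
have Nw : nbhs w D by exact: open_nbhs_nbhs.
have near1 : \forall p \near (z, w), D p.1
  by exact: (@cvg_fst _ _ (nbhs z) (nbhs w) _ D Nz).
have near2 : \forall p \near (z, w), D p.2
  by exact: (@cvg_snd _ _ (nbhs z) (nbhs w) _ D Nw).
apply: filterS3 near_steps near1 near2 => p pf Dp1 Dp2.
apply: le_trans (chain_inf_le (y := Y p) _) _.
  split => [j jm||]; rewrite /Y//.
  - by case: eqP => // _; case: eqP => // _; exact: Dy.
  - by case: eqP m0 => [->|_]//; rewrite eqxx.
apply: le_trans (ler_sum _ (fun j _ => pf j)) _.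
rewrite big_split/= sumr_const card_ord.
have -> : d *+ m = e / 2 by rewrite /d -mulr_natr divfK// pnatr_eq0 -lt0n.
move: ye; rewrite /chain_sum; lra.
Qed.

Lemma chain_inf_usc_uniformly :
  usc_on_uniformly (D `*` D) (fun m p => chain_inf D f m p.1 p.2).
Proof.
apply: usc_uniformly_of_decreasing.
- move=> m m0 [z w] [/= Dz Dw] e e0; rewrite near_withinE.
  have := chain_inf_usc m0 Dz Dw e0; by apply: filterS => p + _.
- by move=> m k [z w] m0 [/= Dz Dw]; exact: chain_inf_decreasing.
- by move=> m [z w] _; exact: chain_inf_ge0.
Qed.

End Chains.

(** * Upper semicontinuity of the Kobayashi-Royden metric and of its sums *)

Section Kappa.
Context {R : realType} {n : nat}.
Notation C := (Cplx R).
Notation V := 'rV[C]_n.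
Implicit Types (D : set V) (z w X : V) (phi psi : C -> V).

Lemma kappa_ge0 D z X : 0 <= kappa D z X.
Proof. by apply: ge0_inf => _ [a _ <-]; exact: modulus_ge0. Qed.

Lemma kappa_le D z X (a : C) phi : disc_tangent D z X a phi ->
  kappa D z X <= modulus a.
Proof.
move=> zX; apply: ge_inf; last by exists a => //; exists phi.
by exists 0 => _ [b _ <-]; exact: modulus_ge0.
Qed.

Lemma kappa0 D z : D z -> kappa D z 0 = 0.
Proof.
move=> Dz; apply/le_anti; rewrite kappa_ge0 andbT -(@modulus0 R).
apply: (@kappa_le _ _ _ _ (fun=> z)); split => //.
by rewrite scale0r.
Qed.

Lemma derive1_is_derive (W : normedModType C) (f : C -> W) (x : C) (l : W) :
  is_derive x 1 f l -> derive1 f x = l.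
Proof. by move=> [_ <-]; rewrite derive1E. Qed.

Lemma analytic_disc_is_derive0 D phi : analytic_disc D phi ->
  is_derive (0 : C) 1 phi (derive1 phi 0).
Proof.
move=> Dphi; rewrite derive1E; apply: derivableP.
by apply: analytic_disc_derivable Dphi _; rewrite modulus0.
Qed.

(** With [c = a^-1], the vector [a / r] times this derivative is [a *: derive1
    phi 0 + v]. *)
Lemma is_derive_perturbed_disc D phi (c : C) (r : R) (u v : V) :
  analytic_disc D phi ->
  is_derive (0 : C) 1 (perturbed_disc phi c r u v)
    ((r%:C)%C *: (derive1 phi 0 + c *: v)).
Proof.
move=> Dphi; have := analytic_disc_is_derive0 Dphi => dphi.
pose g x := phi x + u + (x * c) *: v.
have dg : is_derive ((r%:C)%C * 0 : C) 1 g (derive1 phi 0 + c *: v).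
  rewrite mulr0 /g -[X in X + c *: v]addr0.
  by apply: is_deriveD (is_derive_line _ _ _);
    exact: is_deriveD (is_derive_cst _ _ _).
exact: (is_derive_scale dg).
Qed.

(** The infimum is over a nonempty set: through [z] there is a small affine
    disc in the direction of [X]. *)
Lemma kappa_adherent D z X (e : R) : open D -> D z -> 0 < e ->
  exists (a : C) phi, disc_tangent D z X a phi /\ modulus a < kappa D z X + e.
Proof.
move=> oD Dz e0; have half01 : 0 < (1 / 2 : R) < 1 by lra.
have near0 := near_perturbed_disc 1 oD (constant_disc Dz) half01.
have : \forall t \near (0 : C), analytic_disc D
  (perturbed_disc (fun=> z) 1 (1 / 2) 0 (t *: X)).
  have tX : (fun t : C => ((0 : V), t *: X)) @ nbhs (0 : C) -->
    ((0 : V), (0 : V)).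
    have c2 : (fun t : C => t *: X) @ nbhs (0 : C) --> (0 : V).
      by rewrite -(scale0r X); exact: cvgZr_tmp.
    exact: (cvg_pair (cvg_cst _) c2).
  exact: (tX _ near0).
move=> /nbhs_modulusP[d d0 dP]; pose t : C := ((d / 2)%:C)%C.
have t0 : t != 0 by rewrite -modulus_gt0 modulus_real normr_gt0 gt_eqF//
  divr_gt0.
have {}dP : analytic_disc D (perturbed_disc (fun=> z) 1 (1 / 2) 0 (t *: X)).
  apply: dP; rewrite subr0 modulus_real gtr0_norm ?divr_gt0//.
  by rewrite ltr_pdivrMr// mulr2n mulrDr mulr1 ltrDl.
have [|_ [b [psi zX <-] bl]] := @inf_adherent R _ e e0 (_ : has_inf
    [set modulus a | a in [set a | exists phi, disc_tangent D z X a phi]]).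
  split; last by exists 0 => _ [b _ <-]; exact: modulus_ge0.
  pose a : C := (((1 / 2 : R)%:C)%C * t)^-1.
  exists (modulus a), a => //; exists
    (perturbed_disc (fun=> z) 1 (1 / 2) 0 (t *: X)).
  split => //; first by rewrite /perturbed_disc mulr0 mul0r scale0r !addr0.
  have := is_derive_perturbed_disc 1 (1 / 2) 0 (t *: X) (constant_disc Dz).
  move=> /derive1_is_derive ->; rewrite derive1_cst add0r scale1r !scalerA
    -mulrA mulVf ?scale1r//.
  by rewrite mulf_neq0// -modulus_gt0 modulus_real normr_gt0 gt_eqF//; lra.
by exists b, psi.
Qed.

(** As for [ell_adherent_neq0]: if the parameter is 0 then [X] = 0, and the
    constant disc goes with any other parameter. *)
Lemma kappa_adherent_neq0 D z X (e : R) : open D -> D z -> 0 < e ->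
  exists (a : C) phi,
    [/\ disc_tangent D z X a phi, a != 0 & modulus a < kappa D z X + e].
Proof.
move=> oD Dz e0; have [a [phi [zX al]]] := kappa_adherent X oD Dz e0.
have [a0|a0] := eqVneq a 0; last by exists a, phi.
have X0 : X = 0 by case: zX => _ _ <-; rewrite a0 scale0r.
exists ((e / 2)%:C)%C, (fun=> z); split.
- by split; [exact: constant_disc| |rewrite derive1_cst scaler0 X0].
- by rewrite -modulus_gt0 modulus_real normr_gt0 gt_eqF// divr_gt0.
- rewrite modulus_real gtr0_norm ?divr_gt0// ltr_wpDl ?kappa_ge0//.
  by rewrite ltr_pdivrMr// mulr2n mulrDr mulr1 ltrDl.
Qed.

(** The perturbed disc of [near_perturbed_disc] with [u = z' - z] and [v = X'
    - X] is centered at [z'] and tangent to [X']. *)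
Lemma kappa_usc D z X (e : R) : open D -> D z -> 0 < e ->
  \forall p \near (z, X), kappa D p.1 p.2 <= kappa D z X + e.
Proof.
move=> oD Dz e0; have [a [phi [[Dphi phi0 phiX] a0 ae]]] :=
  kappa_adherent_neq0 X oD Dz e0.
have c0 : 0 < kappa D z X + e by rewrite ltr_wpDl// kappa_ge0.
pose q := modulus a / (kappa D z X + e).
have q1 : 0 <= q < 1 by rewrite divr_ge0 ?modulus_ge0 ?(ltW c0)//= ltr_pdivrMr//
  mul1r.
pose r := (q + 1) / 2.
have r01 : 0 < r < 1 by rewrite /r; lra.
have /andP[r0 r1] := r01.
have arc : modulus a / r <= kappa D z X + e.
  by rewrite ler_pdivrMr// mulrC -ler_pdivrMr// -/q /r; lra.
have near_ab := near_perturbed_disc a^-1 oD Dphi r01.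
have cvg0 : (fun p : V * V => (p.1 - z, p.2 - X)) @ nbhs (z, X) -->
  ((0 : V), (0 : V)).
  have c1 : (fun p : V * V => p.1 - z) @ nbhs (z, X) --> (0 : V).
    by rewrite -(subrr z); apply: cvgB; [exact: cvg_fst|exact: cvg_cst].
  have c2 : (fun p : V * V => p.2 - X) @ nbhs (z, X) --> (0 : V).
    by rewrite -(subrr X); apply: cvgB; [exact: cvg_snd|exact: cvg_cst].
  exact: (cvg_pair c1 c2).
have : \forall p \near (z, X), analytic_disc D
  (perturbed_disc phi a^-1 r (p.1 - z) (p.2 - X)).
  exact: (cvg0 _ near_ab).
apply: filterS => -[z' X'] /= Dp; apply: le_trans arc.
have -> : modulus a / r = modulus (a / (r%:C)%C).
  by rewrite modulusM modulusV modulus_real gtr0_norm.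
have rN0 : (r%:C)%C != 0 :> C by rewrite -modulus_gt0 modulus_real normr_gt0
  gt_eqF.
apply: (kappa_le (phi := perturbed_disc phi a^-1 r (z' - z) (X' - X)));
  split => //.
- by rewrite /perturbed_disc mulr0 mul0r scale0r addr0 phi0 addrC subrK.
- have := is_derive_perturbed_disc a^-1 r (z' - z) (X' - X) Dphi.
  move=> /derive1_is_derive ->; rewrite scalerA divfK// scalerDr phiX scalerA
    divff//.
  by rewrite scale1r addrC subrK.
Qed.

Lemma kappa_scale_le D z X (t : R) : open D -> D z -> 0 < t ->
  kappa D z ((t%:C)%C *: X) <= t * kappa D z X.
Proof.
move=> oD Dz t0; apply/ler_addgt0Pr => e e0.
have [a [phi [[Dphi phi0 phiX] ae]]] := kappa_adherent X oD Dz (divr_gt0 e0 t0).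
apply: (@le_trans _ _ (modulus ((t%:C)%C * a))).
  by apply: (@kappa_le _ _ _ _ phi); split => //; rewrite -scalerA phiX.
rewrite modulusM modulus_real gtr0_norm// mulrC -ler_pdivlMr//.
by apply/ltW; rewrite mulrDl (mulrC t) mulfK// gt_eqF.
Qed.

Section Sums.
Variable D : set V.
Hypothesis oD : open D.

Lemma kappa_m_ge0 m z X : 0 <= kappa_m D m z X.
Proof. by apply: ge0_inf => _ [Xs _ <-]; apply: sumr_ge0 => *;
  exact: kappa_ge0. Qed.

Lemma kappa_m_le m z X (Xs : 'I_m -> V) : decomposition X Xs ->
  kappa_m D m z X <= \sum_j kappa D z (Xs j).
Proof.
move=> XXs; apply: ge_inf; last by exists Xs.
by exists 0 => _ [Ys _ <-]; apply: sumr_ge0 => *; exact: kappa_ge0.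
Qed.

Lemma kappa_m_adherent m z X (e : R) : (0 < m)%N -> 0 < e ->
  exists2 Xs : 'I_m -> V, decomposition X Xs &
    \sum_j kappa D z (Xs j) < kappa_m D m z X + e.
Proof.
move=> m0 e0; have [|_ [Xs XXs <-] Xe] := @inf_adherent R _ e e0 (_ : has_inf
    [set \sum_j kappa D z (Xs j) | Xs in @decomposition R n m X]).
  split; last by exists 0 => _ [Ys _ <-]; apply: sumr_ge0 => *;
    exact: kappa_ge0.
  pose Xs (j : 'I_m) := if j == Ordinal m0 then X else 0.
  exists (\sum_j kappa D z (Xs j)), Xs => //.
  by rewrite /decomposition -big_mkcond/= big_pred1_eq.
by exists Xs.
Qed.

(** A decomposition is completed by zero vectors, on which [kappa] vanishes. *)
Lemma kappa_m_decreasing m k z X : (0 < m)%N -> D z ->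
  kappa_m D (m + k) z X <= kappa_m D m z X.
Proof.
move=> m0 Dz; apply/ler_addgt0Pr => e e0.
have [Xs XXs Xe] := kappa_m_adherent z X m0 e0.
pose Ys (j : 'I_(m + k)) :=
  match fintype.split j with inl i => Xs i | inr _ => 0 end.
have Yl i : Ys (lshift k i) = Xs i.
  by rewrite /Ys -[lshift k i]/(unsplit (inl i)) unsplitK.
have Yr i : Ys (rshift m i) = 0.
  by rewrite /Ys -[rshift m i]/(unsplit (inr i)) unsplitK.
apply: le_trans (ltW Xe); apply: le_trans (kappa_m_le (Xs := Ys) _ _) _.
  rewrite /decomposition big_split_ord/= [X in _ + X]big1 ?addr0//.
  by under eq_bigr do rewrite Yl.
rewrite big_split_ord/= [X in _ + X]big1 ?addr0.
  by under eq_bigr do rewrite Yl.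
by move=> i _; rewrite Yr kappa0.
Qed.

(** The difference [X' - X] is added to one vector of a nearly minimal
    decomposition; the others are kept. *)
Lemma kappa_m_usc m z X (e : R) : (0 < m)%N -> D z -> 0 < e ->
  \forall p \near (z, X), kappa_m D m p.1 p.2 <= kappa_m D m z X + e.
Proof.
move=> m0 Dz e0; have e2 : 0 < e / 2 by rewrite divr_gt0.
have [Xs XXs Xe] := kappa_m_adherent z X m0 e2.
pose Y (p : V * V) (j : 'I_m) := Xs j + if j == Ordinal m0 then p.2 - X else 0.
have Ycvg j : (fun p => Y p j) @ nbhs (z, X) --> Xs j.
  rewrite /Y -[X in _ --> X]addr0; apply: cvgD; first exact: cvg_cst.
  case: eqP => _; last exact: cvg_cst.
  by rewrite -(subrr X); apply: cvgB; [exact: cvg_snd|exact: cvg_cst].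
pose d := e / 2 / m%:R; have d0 : 0 < d by rewrite divr_gt0// ltr0n.
have : \forall p \near (z, X), forall j : 'I_m,
    kappa D p.1 (Y p j) <= kappa D z (Xs j) + d.
  apply: (@filter_forall _ _ _ _ (nbhs_filter (z, X))) => j.
  have Yj : (fun p : V * V => (p.1, Y p j)) @ nbhs (z, X) --> (z, Xs j).
    exact: (cvg_pair cvg_fst (Ycvg j)).
  exact: (Yj _ (kappa_usc (Xs j) oD Dz d0)).
apply: filterS => p pY; apply: le_trans (kappa_m_le (Xs := Y p) _ _) _.
  by rewrite /decomposition /Y big_split/= XXs -big_mkcond/= big_pred1_eq addrC
    subrK.
apply: le_trans (ler_sum _ (fun j _ => pY j)) _.
rewrite big_split/= sumr_const card_ord.
have -> : d *+ m = e / 2 by rewrite /d -mulr_natr divfK// pnatr_eq0 -lt0n.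
lra.
Qed.

Lemma kappa_m_usc_uniformly :
  usc_on_uniformly (D `*` setT) (fun m p => kappa_m D m p.1 p.2).
Proof.
apply: usc_uniformly_of_decreasing.
- move=> m m0 [z X] [/= Dz _] e e0; rewrite near_withinE.
  have := kappa_m_usc X m0 Dz e0; by apply: filterS => p + _.
- by move=> m k [z X] m0 [/= Dz _]; exact: kappa_m_decreasing.
- by move=> m [z X] _; exact: kappa_m_ge0.
Qed.

Lemma kappa_hat_le m z X : (0 < m)%N -> kappa_hat D z X <= kappa_m D m z X.
Proof.
move=> m0; apply: ge_inf; last by exists m.
by exists 0 => _ [k _ <-]; exact: kappa_m_ge0.
Qed.

Lemma kappa_hat_adherent z X (e : R) : 0 < e ->
  exists2 m, (0 < m)%N & kappa_m D m z X < kappa_hat D z X + e.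
Proof.
move=> e0; have [|_ [m m0 <-] me] := @inf_adherent R _ e e0 (_ : has_inf
    [set kappa_m D m z X | m in [set m | (0 < m)%N]]).
  by split; [exists (kappa_m D 1 z X), 1%N|exists 0 => _ [k _ <-];
    exact: kappa_m_ge0].
by exists m.
Qed.

Lemma kappa_hat_usc z X (e : R) : D z -> 0 < e ->
  \forall p \near (z, X), kappa_hat D p.1 p.2 <= kappa_hat D z X + e.
Proof.
move=> Dz e0; have e2 : 0 < e / 2 by rewrite divr_gt0.
have [m m0 me] := kappa_hat_adherent z X e2.
have := kappa_m_usc X m0 Dz e2; apply: filterS => p pm.
by apply: le_trans (kappa_hat_le _ _ m0) _; lra.
Qed.

End Sums.
End Kappa.

(** * Limits of analytic discs in a taut domain *)

Section TautLimits.
Context {R : realType} {n : nat}.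
Notation C := (Cplx R).
Notation V := 'rV[C]_n.
Implicit Types (phi : nat -> C -> V) (psi : C -> V).

Lemma row_sequence_limit_unique (u : nat -> V) (a b : V) :
  u @ \oo --> a -> u @ \oo --> b -> a = b.
Proof. by apply: cvg_unique; exact: norm_hausdorff. Qed.

(** The values are taken at moving points, as the parameters of minimizing
    discs move with the discs. *)
Lemma locally_uniform_cvg (D : set V) phi psi (a : nat -> C) (l : C) :
  analytic_disc D psi -> converges_locally_uniformly phi psi ->
  modulus l < 1 -> a @ \oo --> l -> (fun k => phi k (a k)) @ \oo --> psi l.
Proof.
move=> Dpsi lu l1 al; have /unit_discE/lu[U lU uU] := l1.
apply/cvg_rowP => i; apply/cvg_modulusP => e e0.
have e2 : 0 < e / 2 by rewrite divr_gt0.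
have psia : (fun k => psi (a k)) @ \oo --> psi l.
  apply: (cvg_comp _ _ al); exact/derivable_cvg/(analytic_disc_derivable Dpsi).
have /cvg_rowP/(_ i)/cvg_modulusP/(_ _ e2) near1 := psia.
have near2 := uniform_cvgP uU e2.
have near3 : \forall k \near \oo, U (a k) by exact: al.
apply: filterS3 near1 near2 near3 => k h1 h2 Uak.
have {}h2 := h2 _ Uak i.
rewrite -(subrK (psi (a k) ord0 i) (phi k _ _ _)) -addrA.
by apply: le_trans (le_modulusD _ _) _; lra.
Qed.

(** Weierstrass' theorem: the Cauchy estimate bounds the derivative at 0 of
    [phi k - psi] by the maximum of this difference on a small closed disc. *)
Lemma locally_uniform_cvg_derive (D : set V) phi psi :
  (forall k, analytic_disc D (phi k)) -> analytic_disc D psi ->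
  converges_locally_uniformly phi psi ->
  (fun k => derive1 (phi k) 0) @ \oo --> derive1 psi 0.
Proof.
move=> Dphi Dpsi lu; apply/cvg_rowP => i; apply/cvg_modulusP => e e0.
have /lu[U /nbhs_modulusP[d d0 dU] uU] : unit_disc (0 : C).
  by apply/unit_discE; rewrite modulus0.
pose r := Num.min (d / 2) (1 / 2).
have r0 : 0 < r by rewrite lt_min !divr_gt0.
have [rd r1] : r < d /\ r < 1.
  by split; rewrite gt_min; apply/orP; [left|right]; lra.
have er : 0 < e * r / 4 by rewrite divr_gt0// mulr_gt0.
have := uniform_cvgP uU er; apply: filterS => k kU.
pose g x : C := phi k x ord0 i - psi x ord0 i.
have dcoord f (x : C) : analytic_disc D f -> modulus x < 1 ->
    derivable (fun y => f y ord0 i) x 1.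
  move=> Df x1; have /derivableP/is_derive_rowP/(_ i)[] // :=
    analytic_disc_derivable Df x1.
have dg (x : C) : modulus x < 1 -> derivable g x 1.
  by move=> x1; apply: derivableB; apply: dcoord.
have coordE f : analytic_disc D f ->
    is_derive (0 : C) 1 (fun y => f y ord0 i) (derive1 f 0 ord0 i).
  by move=> /analytic_disc_is_derive0/is_derive_rowP.
have -> : derive1 (phi k) 0 ord0 i - derive1 psi 0 ord0 i = derive1 g 0.
  apply/esym/derive1_is_derive; exact: is_deriveB (coordE _ (Dphi k))
    (coordE _ Dpsi).
have r01 : 0 < r < 1 by rewrite r0.
have gM z : modulus z <= r -> modulus (g z) <= e * r / 4.
  move=> zr; apply/ltW/kU; apply: dU; rewrite subr0; exact: le_lt_trans rd.
apply: le_trans (cauchy_estimate r01 dg gM) _.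
by rewrite (mulrC 4) divfK// mulfK// gt_eqF.
Qed.

Variable D : set V.
Hypotheses (oD : open D) (tautD : taut D).

(** Compact divergence is excluded by the compact set {0} and a compact
    neighborhood of [z], which contains almost all the centers [phi k 0]. *)
Lemma taut_extraction phi (z : V) : (forall k, analytic_disc D (phi k)) ->
  D z -> (fun k => phi k 0) @ \oo --> z ->
  exists2 s : nat -> nat, {homo s : i j / (i < j)%N} &
    exists2 psi, analytic_disc D psi &
      converges_locally_uniformly (phi \o s) psi.
Proof.
move=> Dphi Dz phiz; have [s s_incr [//|div]] := tautD Dphi; first by exists s.
have [L [cL LD zL]] := compact_nbhs_in_open oD Dz.
have disc0 : [set (0 : C)] `<=` unit_disc.
  by move=> _ ->; apply/unit_discE; rewrite modulus0.
have near1 := div _ _ (@compact_set1 _ (0 : C)) disc0 cL LD.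
have near2 : \forall k \near \oo, L (phi (s k) 0).
  exact: (subsequence_cvg s_incr phiz zL).
have [k [k1 k2]] := filter_ex (filterI near1 near2).
by have : set0 (phi (s k) 0) by rewrite -k1; split => //; exists 0.
Qed.

Lemma taut_bounded_extraction phi (z : V) (a : nat -> C) (M : R) :
  (forall k, analytic_disc D (phi k)) -> D z ->
    (fun k => phi k 0) @ \oo --> z ->
  (forall k, modulus (a k) <= M) ->
  exists s psi l, [/\ {homo s : i j / (i < j)%N}, analytic_disc D psi,
    converges_locally_uniformly (phi \o s) psi, (a \o s) @ \oo --> (l : C) &
    modulus l <= M /\ psi 0 = z].
Proof.
move=> Dphi Dz phiz aM; have [s1 s1_incr [l al]] := bounded_subsequence aM.
have [s2 s2_incr [psi Dpsi lu]] := @taut_extraction (phi \o s1) z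
  (fun k => Dphi _) Dz (subsequence_cvg s1_incr phiz).
have s_incr : {homo s1 \o s2 : i j / (i < j)%N}.
  by move=> i j ij; apply: s1_incr; exact: s2_incr.
exists (s1 \o s2), psi, l; split => //; last split.
- exact: (subsequence_cvg s2_incr al).
- apply: (@closed_cvg _ _ _ eventually_filter (fun k => modulus (a (s1 k)))
  [set x | x <= M]).
  + exact: closed_le.
  + by apply: nearW => k; exact: aM.
  + apply: (cvg_comp _ _ al); exact: continuous_modulus.
- have l0 : modulus (0 : C) < 1 by rewrite modulus0.
  have psi0 : (fun k => phi (s1 (s2 k)) 0) @ \oo --> psi 0.
    exact: (locally_uniform_cvg Dpsi lu l0 (cvg_cst _)).
  exact: (row_sequence_limit_unique psi0 (subsequence_cvg s_incr phiz)).
Qed.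

(** The bound [rho < 1] keeps the limit of the parameters in the open disc, so
    that the limit disc has a value there, which is the limit of the [y' k]. *)
Lemma disc_through_extraction (y y' : nat -> V) (z : V) (a : nat -> C) phi
  (rho : R) :
  (forall k, disc_through D (y k) (y' k) (a k) (phi k)) ->
  (forall k, modulus (a k) <= rho) -> rho < 1 -> D z -> y @ \oo --> z ->
  exists s (w : V) (l : C) psi, [/\ {homo s : i j / (i < j)%N},
    (y' \o s) @ \oo --> w, disc_through D z w l psi,
      (a \o s) @ \oo --> l & modulus l <= rho].
Proof.
move=> zw arho rho1 Dz yz.
have phiz : (fun k => phi k 0) @ \oo --> z.
  by rewrite (_ : (fun k => _) = y)//; apply/funext => k; case: (zw k).
have Dphi k : analytic_disc D (phi k) by case: (zw k).
have [s [psi [l [s_incr Dpsi lu al [lrho psi0]]]]] :=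
  taut_bounded_extraction Dphi Dz phiz arho.
have l1 : modulus l < 1 by exact: le_lt_trans rho1.
exists s, (psi l), l, psi; split;
  [exact: s_incr| |split; [exact/unit_discE|exact: Dpsi|exact: psi0|by []]
  |exact: al|exact: lrho].
have := locally_uniform_cvg Dpsi lu l1 al.
have -> : (fun k => (phi \o s) k (a (s k))) = y' \o s.
  by apply/funext => k /=; case: (zw (s k)).
exact.
Qed.

Lemma disc_tangent_extraction (y X : nat -> V) (z : V) (a : nat -> C) phi
  (M : R) :
  (forall k, disc_tangent D (y k) (X k) (a k) (phi k)) ->
  (forall k, modulus (a k) <= M) -> D z -> y @ \oo --> z ->
  exists s (Y : V) (l : C) psi, [/\ {homo s : i j / (i < j)%N},
    (X \o s) @ \oo --> Y, disc_tangent D z Y l psi,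
      (a \o s) @ \oo --> l & modulus l <= M].
Proof.
move=> zX aM Dz yz.
have phiz : (fun k => phi k 0) @ \oo --> z.
  by rewrite (_ : (fun k => _) = y)//; apply/funext => k; case: (zX k).
have Dphi k : analytic_disc D (phi k) by case: (zX k).
have [s [psi [l [s_incr Dpsi lu al [lM psi0]]]]] :=
  taut_bounded_extraction Dphi Dz phiz aM.
exists s, (l *: derive1 psi 0), l, psi; split;
  [exact: s_incr| |split; [exact: Dpsi|exact: psi0|by []]|exact: al|exact: lM].
have -> : X \o s = (fun k => (a \o s) k *: derive1 ((phi \o s) k) 0).
  by apply/funext => k /=; case: (zX (s k)).
have dcvg := locally_uniform_cvg_derive (fun k => Dphi (s k)) Dpsi lu.
exact: (cvgZ al dcvg).
Qed.

End TautLimits.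

(** * Minimal chains in a taut domain *)

Section TautDistances.
Context {R : realType} {n : nat}.
Notation C := (Cplx R).
Notation V := 'rV[C]_n.
Variable D : set V.
Hypotheses (dD : domain D) (tautD : taut D).
Let oD : open D. Proof. by case: dD. Qed.

Lemma harmonic_le (c : R) : 0 < c -> \forall k \near \oo, (k.+1%:R)^-1 <= c.
Proof.
move=> c0; have /cvgrPdist_le/(_ _ c0) := @cvg_harmonic R.
by apply: filterS => k; rewrite sub0r normrN ger0_norm// /harmonic invr_ge0.
Qed.

Lemma ell_attained z w : D z -> D w ->
  exists (a : C) phi, disc_through D z w a phi /\ modulus a = ell D z w.
Proof.
move=> Dz Dw; have l1 := ell_lt1 dD Dz Dw.
pose gap := (1 - ell D z w) / 2; have gap0 : 0 < gap
  by rewrite divr_gt0// subr_gt0.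
pose d (k : nat) := Num.min gap (k.+1%:R)^-1.
have d0 k : 0 < d k by rewrite lt_min gap0 invr_gt0 ltr0n.
have /choice[a /choice[phi aP]] : forall k, exists (a : C) , exists phi : C ->
  V,
    disc_through D z w a phi /\ modulus a < ell D z w + d k.
  by move=> k; exact: ell_adherent.
have arho k : modulus (a k) <= ell D z w + gap.
  apply/ltW; case: (aP k) => _ /lt_le_trans; apply.
  by rewrite lerD2l ge_min lexx.
(* This margin keeps the parameters away from the unit circle. *)
have rho1 : ell D z w + gap < 1 by rewrite /gap; lra.
have [s [w' [l [psi [s_incr ww' zw' al _]]]]] :=
  disc_through_extraction oD tautD
  (fun k => (aP k).1) arho rho1 Dz (cvg_cst z).
have {}ww' : w' = w.
  exact: (row_sequence_limit_unique ww' (cvg_cst w)).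
exists l, psi; rewrite -ww'; split => //; apply/le_anti;
  rewrite (ell_le zw') andbT.
apply/ler_addgt0Pr => e e0; rewrite ww'.
apply: (@closed_cvg _ _ _ eventually_filter (fun k => modulus (a (s k)))
  [set x | x <= ell D z w + e]).
- exact: closed_le.
- have := subsequence_cvg s_incr (@cvg_harmonic R) => /cvgrPdist_le/(_ _ e0).
  apply: filterS => k; rewrite sub0r normrN ger0_norm ?invr_ge0// => ke.
  apply/ltW; case: (aP (s k)) => _ /lt_le_trans; apply.
  by rewrite lerD2l ge_min; apply/orP; right.
- by apply: (cvg_comp _ _ al); exact: continuous_modulus.
Qed.

(** Along pairs with too small values, discs converge to a disc that would
    beat [ell D z w]. *)
Lemma ell_lsc z w (e : R) : D z -> D w -> 0 < e ->
  \forall p \near (z, w), D p.1 -> D p.2 -> ell D z w - e <= ell D p.1 p.2.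
Proof.
move=> Dz Dw e0; apply: contrapT => /not_near_sequence[p pzw pP].
have {}pP k : [/\ D (p k).1, D (p k).2 & ell D (p k).1 (p k).2 < ell D z w - e].
  have := pP k; move=> /not_implyP[D1 /not_implyP[D2 /negP]].
  by rewrite -ltNge.
have p1 : (fun k => (p k).1) @ \oo --> z by exact: (cvg_comp _ _ pzw cvg_fst).
have p2 : (fun k => (p k).2) @ \oo --> w by exact: (cvg_comp _ _ pzw cvg_snd).
have /choice[a /choice[phi aP]] : forall k, exists (a : C) , exists phi : C ->
  V,
    disc_through D (p k).1 (p k).2 a phi /\ modulus a < ell D z w - e.
  move=> k; have [D1 D2] := pP k; rewrite -subr_gt0 => /(ell_adherent dD D1 D2).
  by move=> [a [phi]]; rewrite addrC subrK => ?; exists a, phi.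
have rho1 : ell D z w - e < 1 by have := ell_lt1 dD Dz Dw; lra.
have [s [w' [l [psi [s_incr ww' zw' al ll]]]]] :=
  disc_through_extraction oD tautD
  (fun k => (aP k).1) (fun k => ltW (aP k).2) rho1 Dz p1.
have {}ww' : w' = w.
  exact: (row_sequence_limit_unique ww' (subsequence_cvg s_incr p2)).
by have := le_trans (ell_le zw') ll; rewrite ww'; lra.
Qed.

Lemma lempert_lsc z w (e : R) : D z -> D w -> 0 < e ->
  \forall p \near (z, w), D p.1 -> D p.2 ->
    lempert D z w - e <= lempert D p.1 p.2.
Proof.
move=> Dz Dw e0; pose c := tanh (lempert D z w - e).
have lc : c < ell D z w.
  by apply: lt_artanh_tanh; [exact: ell_itv|rewrite gtrBl].
have := @ell_lsc z w (ell D z w - c) Dz Dw; rewrite subr_gt0 => /(_ lc).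
apply: filterS => p + D1 D2 => /(_ D1 D2); rewrite subKr => pc.
rewrite -[leLHS]tanhK; apply: le_artanh => //; last exact: ell_lt1.
by case/andP: (tanh_itv (lempert D z w - e)).
Qed.

(** One link after the other: once the starting points of the links number j
    converge in [D], their end points converge in [D] along a subsequence,
    being values of discs with converging centers. *)
Lemma chain_extraction (m : nat) (y : nat -> nat -> V) (z : V)
  (rho : R) : rho < 1 ->
  D z -> (fun k => y k 0%N) @ \oo --> z ->
  (forall k j, (j <= m)%N -> D (y k j)) ->
  (forall k j, (j < m)%N -> ell D (y k j) (y k j.+1) < rho) ->
  exists2 s : nat -> nat, {homo s : i j / (i < j)%N} &
    exists x : nat -> V, forall j, (j <= m)%N ->
      D (x j) /\ (fun k => y (s k) j) @ \oo --> x j.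
Proof.
move=> rho1 Dz y0; elim: m => [|m IH] Dy yell.
  by exists id => //; exists (fun=> z) => j; rewrite leqn0 => /eqP ->.
have [|k j jm|s s_incr [x xP]] := IH.
- by move=> k j jm; apply: Dy; exact: leqW.
- by apply: yell; exact: ltnW.
have [Dxm yxm] := xP m (leqnn m).
have /choice[a /choice[phi aP]] : forall k, exists (a : C) , exists phi : C ->
  V,
    disc_through D (y (s k) m) (y (s k) m.+1) a phi /\ modulus a < rho.
  move=> k; have := yell (s k) m (ltnSn m); rewrite -subr_gt0 => gap0.
  have [a [phi]] := ell_adherent dD (Dy (s k) _ (leqnSn m))
    (Dy (s k) _ (leqnn m.+1)) gap0.
  by rewrite addrC subrK => aP; exists a, phi.
have [s' [w [l [psi [s'_incr yw [_ Dpsi _ psil] _ ll]]]]] :=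
  disc_through_extraction oD tautD (fun k => (aP k).1) (fun k => ltW (aP k).2)
    rho1 Dxm yxm.
have Dw : D w.
  by rewrite -psil; apply: analytic_disc_in Dpsi _; exact: le_lt_trans rho1.
exists (s \o s'); first by move=> i j ij; apply: s_incr; exact: s'_incr.
exists (fun j => if (j <= m)%N then x j else w) => j;
  rewrite leq_eqVlt => /predU1P[->|].
  rewrite ltnn; split; [exact: Dw|exact: yw].
rewrite ltnS => jm; rewrite jm; have [Dxj yxj] := xP j jm.
split; [exact: Dxj|exact: (subsequence_cvg s'_incr yxj)].
Qed.

Section ChainFunctional.
Variable f : V -> V -> R.
Hypothesis f_ge0 : forall z w, D z -> D w -> 0 <= f z w.
Hypothesis f_lsc : forall z w (e : R), D z -> D w -> 0 < e ->
  \forall p \near (z, w), D p.1 -> D p.2 -> f z w - e <= f p.1 p.2.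

(** Minimizing chains for fixed or for converging end points have a limit
    chain, and lower semicontinuity of [f] bounds its sum. Applied to fixed
    end points this shows that the infimum is attained, and applied to moving
    ones that it is lower semicontinuous. *)
Lemma chain_limit (m : nat) (y : nat -> nat -> V) (z w : V) (zs ws : nat -> V)
  (rho c : R) :
  (0 < m)%N -> rho < 1 -> D z -> D w -> zs @ \oo --> z -> ws @ \oo --> w ->
  (forall k, chain D m (zs k) (ws k) (y k)) ->
  (forall k j, (j < m)%N -> ell D (y k j) (y k j.+1) < rho) ->
  (forall e, 0 < e -> \forall k \near \oo, chain_sum f m (y k) <= c + e) ->
  exists2 x, chain D m z w x & chain_sum f m x <= c.
Proof.
move=> m0 rho1 Dz Dw zsz wsw yP yell yc.
have [||s s_incr [x xP]] := @chain_extraction m y z rho rho1 Dz _ _ yell.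
- have -> : (fun k => y k 0%N) = zs by apply/funext => k; case: (yP k).
  exact: zsz.
- by move=> k j jm; case: (yP k) => H _ _; exact: H.
have cx : chain D m z w x.
  split => [j /xP[]//||].
    have [_ x0] := xP 0%N (leq0n m).
    apply: (row_sequence_limit_unique x0).
    have -> : (fun k => y (s k) 0%N) = zs \o s by apply/funext => k /=;
      case: (yP (s k)).
    exact: (subsequence_cvg s_incr zsz).
  have [_ xm] := xP m (leqnn m).
  apply: (row_sequence_limit_unique xm).
  have -> : (fun k => y (s k) m) = ws \o s by apply/funext => k /=;
    case: (yP (s k)).
  exact: (subsequence_cvg s_incr wsw).
exists x => //; apply/ler_addgt0Pr => e e0;
  have e2 : 0 < e / 2 by rewrite divr_gt0.
pose d := e / 2 / m%:R; have d0 : 0 < d by rewrite divr_gt0// ltr0n.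
have near1 : \forall k \near \oo, forall j : 'I_m,
    f (x j) (x j.+1) - d <= f (y (s k) j) (y (s k) j.+1).
  apply: filter_forall => j; have jm := ltn_ord j.
  have [Dxj xj] := xP j (ltnW jm); have [Dxj1 xj1] := xP j.+1 jm.
  have xjj : (fun k => (y (s k) j, y (s k) j.+1)) @ \oo --> (x j, x j.+1).
    exact: (cvg_pair xj xj1).
  have : \forall k \near \oo, D (y (s k) j) -> D (y (s k) j.+1) ->
      f (x j) (x j.+1) - d <= f (y (s k) j) (y (s k) j.+1).
    exact: (xjj _ (f_lsc Dxj Dxj1 d0)).
  by apply: filterS => k; case: (yP (s k)) => Dy _ _; apply; apply: Dy => //;
    exact: ltnW.
have near2 : \forall k \near \oo, chain_sum f m (y (s k)) <= c + e / 2.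
  exact: (cvg_subsequence s_incr (yc _ e2)).
have [k [k1 k2]] := filter_ex (filterI near1 near2).
have : chain_sum f m x - d *+ m <= chain_sum f m (y (s k)).
  rewrite /chain_sum -[X in _ *+ X](card_ord m) -sumr_const -sumrB.
  by apply: ler_sum => j _; exact: k1.
have -> : d *+ m = e / 2 by rewrite /d -mulr_natr divfK// pnatr_eq0 -lt0n.
lra.
Qed.

Variables (m : nat) (z w : V) (b rho : R).
Hypotheses (m_gt0 : (0 < m)%N) (Dz : D z) (Dw : D w).
Hypothesis inf_lt_b : chain_inf D f m z w < b.
Hypothesis rho_lt1 : rho < 1.
(* Steps of cheap chains are realized by discs with parameters in a compact
   part of the unit disc. *)
Hypothesis coercive : forall x y, D x -> D y -> f x y < b -> ell D x y < rho.

(** No step exceeds the whole sum, as the terms are nonnegative. *)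
Lemma chain_step_ell x x' y j : chain D m x x' y -> chain_sum f m y < b ->
  (j < m)%N -> ell D (y j) (y j.+1) < rho.
Proof.
move=> [Dy _ _] yb jm; have Dyi i : (i < m)%N -> D (y i) /\ D (y i.+1).
  by move=> im; split; apply: Dy => //; exact: ltnW.
have [Dj Dj1] := Dyi j jm; apply: coercive => //; apply: le_lt_trans yb.
rewrite /chain_sum (bigD1 (Ordinal jm))//= lerDl; apply: sumr_ge0 => i _.
by have [] := Dyi i (ltn_ord i); exact: f_ge0.
Qed.

Lemma chain_inf_attained_of_coercive : chain_inf_attained D f m z w.
Proof.
pose gap := b - chain_inf D f m z w; have gap0 : 0 < gap by rewrite subr_gt0.
pose d (k : nat) := Num.min gap (k.+1%:R)^-1.
have d0 k : 0 < d k by rewrite lt_min gap0 invr_gt0 ltr0n.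
have /choice[y yP] : forall k, exists y, chain D m z w y /\
    chain_sum f m y < chain_inf D f m z w + d k.
  move=> k; have [y yP ye] := chain_inf_adherent f_ge0 m_gt0 Dz Dw (d0 k).
  by exists y.
have yb k : chain_sum f m (y k) < b.
  case: (yP k) => _ /lt_le_trans; apply.
  by rewrite -[leRHS](subrK (chain_inf D f m z w)) addrC lerD2r ge_min lexx.
have [|||x xP xc] := @chain_limit m y z w (fun=> z) (fun=> w) rho
  (chain_inf D f m z w)
    m_gt0 rho_lt1 Dz Dw (cvg_cst _) (cvg_cst _).
- by move=> k; case: (yP k).
- by move=> k j jm; case: (yP k) => cy _; exact: chain_step_ell cy (yb k) jm.
- move=> e e0; have := harmonic_le e0; apply: filterS => k ke.
  case: (yP k) => _ /ltW/le_trans; apply; rewrite lerD2l ge_min ke; exact: orbT.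
exists x; split => //.
  by apply/le_anti; rewrite xc (chain_inf_le f_ge0 xP).
case: xP => Dx _ _ j jm; apply: ell_attained; apply: Dx => //; exact: ltnW.
Qed.

Lemma chain_inf_lsc (e : R) : 0 < e -> \forall p \near (z, w), D p.1 -> D p.2 ->
  chain_inf D f m z w - e <= chain_inf D f m p.1 p.2.
Proof.
move=> e0; apply: contrapT => /not_near_sequence[p pzw pP].
have {}pP k : [/\ D (p k).1, D (p k).2 &
    chain_inf D f m (p k).1 (p k).2 < chain_inf D f m z w - e].
  have := pP k; move=> /not_implyP[D1 /not_implyP[D2 /negP]].
  by rewrite -ltNge.
have p1 : (fun k => (p k).1) @ \oo --> z by exact: (cvg_comp _ _ pzw cvg_fst).
have p2 : (fun k => (p k).2) @ \oo --> w by exact: (cvg_comp _ _ pzw cvg_snd).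
have /choice[y yP] : forall k, exists y, chain D m (p k).1 (p k).2 y /\
    chain_sum f m y < chain_inf D f m z w - e.
  move=> k; have [D1 D2] := pP k; rewrite -subr_gt0.
  move=> /(chain_inf_adherent f_ge0 m_gt0 D1 D2)[y yP].
  by rewrite addrC subrK => ye; exists y.
have [|||x xP xc] := @chain_limit m y z w _ _ rho (chain_inf D f m z w - e)
    m_gt0 rho_lt1 Dz Dw p1 p2.
- by move=> k; case: (yP k).
- move=> k j jm; case: (yP k) => cy ylt; apply: chain_step_ell cy _ jm.
  by apply: lt_trans ylt (lt_trans _ inf_lt_b); rewrite gtrBl.
- move=> e' e'0; apply: nearW => k; case: (yP k) => _ ylt; lra.
by have := le_trans (chain_inf_le f_ge0 xP) xc; lra.
Qed.

End ChainFunctional.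
End TautDistances.

(** * Minimal decompositions in a taut domain *)

Section TautKappa.
Context {R : realType} {n : nat}.
Notation C := (Cplx R).
Notation V := 'rV[C]_n.
Variable D : set V.
Hypotheses (oD : open D) (tautD : taut D).

(** Subsequences are taken successively for the finitely many indices. *)
Lemma finite_subsequence (I : finType) (u : nat -> I -> V) :
  (forall i (s : nat -> nat), {homo s : i j / (i < j)%N} ->
    exists2 s' : nat -> nat, {homo s' : i j / (i < j)%N} &
      exists l : V, (fun k => u (s (s' k)) i) @ \oo --> l) ->
  exists2 s : nat -> nat, {homo s : i j / (i < j)%N} &
    exists l : I -> V, forall i, (fun k => u (s k) i) @ \oo --> l i.
Proof.
move=> H.
have [s s_incr [l lP]] : exists2 s : nat -> nat, {homo s : i j / (i < j)%N} &
    exists l : I -> V, forall i, i \in enum I ->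
      (fun k => u (s k) i) @ \oo --> l i.
  elim: (enum I) => [|i r [s s_incr [l lP]]].
    by exists id => //; exists (fun=> 0).
  have [s' s'_incr [li uli]] := H i s s_incr.
  exists (s \o s'); first by move=> a b ab; apply: s_incr; exact: s'_incr.
  exists (fun j => if j == i then li else l j) => j; rewrite inE.
  case: eqP => [->|_] /=; first by move=> _; exact: uli.
  by move=> /lP ulj; exact: (subsequence_cvg s'_incr ulj).
exists s => //; exists l => i; apply: lP; exact: mem_enum.
Qed.

Lemma kappa_le_extraction (y X : nat -> V) (z : V) (M : R) :
  (forall k, D (y k)) -> (forall k, kappa D (y k) (X k) < M) ->
  D z -> y @ \oo --> z ->
  exists2 s : nat -> nat, {homo s : i j / (i < j)%N} &
    exists2 Y : V, (X \o s) @ \oo --> Y & kappa D z Y <= M.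
Proof.
move=> Dy XM Dz yz.
have /choice[a /choice[phi aP]] : forall k, exists (a : C), exists phi : C -> V,
    disc_tangent D (y k) (X k) a phi /\ modulus a < M.
  move=> k; have := XM k; rewrite -subr_gt0 => gap0.
  have [a [phi]] := kappa_adherent (X k) oD (Dy k) gap0.
  by rewrite addrC subrK => aP; exists a, phi.
have [s [Y [l [psi [s_incr XY zY _ lM]]]]] := disc_tangent_extraction oD tautD
  (fun k => (aP k).1) (fun k => ltW (aP k).2) Dz yz.
exists s; first exact: s_incr.
by exists Y; [exact: XY|exact: le_trans (kappa_le zY) lM].
Qed.

Lemma kappa_attained z X : D z ->
  exists (a : C) phi, disc_tangent D z X a phi /\ modulus a = kappa D z X.
Proof.
move=> Dz; have /choice[a /choice[phi aP]] : forall k : nat, exists (a : C),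
  exists phi : C -> V,
    disc_tangent D z X a phi /\ modulus a < kappa D z X + (k.+1%:R)^-1.
  by move=> k; apply: kappa_adherent => //; rewrite invr_gt0 ltr0n.
have aM k : modulus (a k) <= kappa D z X + 1.
  case: (aP k) => _ /ltW/le_trans; apply.
  by rewrite lerD2l invf_le1 ?ltr0n// ler1n.
have [s [Y [l [psi [s_incr XY zY al _]]]]] := disc_tangent_extraction oD tautD
  (fun k => (aP k).1) aM Dz (cvg_cst z).
have {}XY : Y = X by exact: (row_sequence_limit_unique XY (cvg_cst X)).
exists l, psi; rewrite -XY; split; first exact: zY.
apply/le_anti; rewrite (kappa_le zY) andbT XY; apply/ler_addgt0Pr => e e0.
apply: (@closed_cvg _ _ _ eventually_filter (fun k => modulus (a (s k)))
  [set x | x <= kappa D z X + e]).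
- exact: closed_le.
- have near_e := cvg_subsequence s_incr (harmonic_le e0).
  have : \forall k \near \oo, ((s k).+1%:R)^-1 <= e by exact: near_e.
  by apply: filterS => k ke; case: (aP (s k)) => _ /ltW/le_trans; apply;
    rewrite lerD2l.
- by apply: (cvg_comp _ _ al); exact: continuous_modulus.
Qed.

Lemma kappa_lsc z X (e : R) : D z -> 0 < e ->
  \forall p \near (z, X), D p.1 -> kappa D z X - e <= kappa D p.1 p.2.
Proof.
move=> Dz e0; apply: contrapT => /not_near_sequence[p pzw pP].
have {}pP k : D (p k).1 /\ kappa D (p k).1 (p k).2 < kappa D z X - e.
  by have := pP k; move=> /not_implyP[D1 /negP]; rewrite -ltNge.
have p1 : (fun k => (p k).1) @ \oo --> z by exact: (cvg_comp _ _ pzw cvg_fst).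
have p2 : (fun k => (p k).2) @ \oo --> X by exact: (cvg_comp _ _ pzw cvg_snd).
have [s s_incr [Y XY zY]] := kappa_le_extraction (fun k => (pP k).1)
  (fun k => (pP k).2) Dz p1.
have YX := row_sequence_limit_unique XY (subsequence_cvg s_incr p2).
by move: zY; rewrite YX; lra.
Qed.

(** As for chains: the vectors of decompositions with bounded sums have a
    limit decomposition, to which lower semicontinuity of [kappa] applies. *)
Lemma kappa_m_limit (m : nat) (y Xs : nat -> V) (Ys : nat -> 'I_m -> V)
  (z X : V) (M c : R) :
  D z -> (forall k, D (y k)) -> y @ \oo --> z -> Xs @ \oo --> X ->
  (forall k, decomposition (Xs k) (Ys k)) ->
  (forall k, \sum_j kappa D (y k) (Ys k j) < M) ->
  (forall e, 0 < e -> \forall k \near \oo,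
    \sum_j kappa D (y k) (Ys k j) <= c + e) ->
  exists2 Zs : 'I_m -> V, decomposition X Zs & \sum_j kappa D z (Zs j) <= c.
Proof.
move=> Dz Dy yz XsX XYs YM Yc.
have stepM k j : kappa D (y k) (Ys k j) < M.
  apply: le_lt_trans (YM k); rewrite (bigD1 j)//= lerDl.
  by apply: sumr_ge0 => i _; exact: kappa_ge0.
have [|s s_incr [Zs ZsP]] := @finite_subsequence 'I_m Ys.
  move=> j s s_incr.
  have [s' s'_incr [Y XY _]] := @kappa_le_extraction (y \o s)
    (fun k => Ys (s k) j) z M
    (fun k => Dy (s k)) (fun k => stepM (s k) j) Dz (subsequence_cvg s_incr yz).
  by exists s'; [exact: s'_incr|exists Y; exact: XY].
have sumZ : (fun k => \sum_j Ys (s k) j) @ \oo --> \sum_j Zs j.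
  by apply: cvg_big => [|j _]; [exact: add_continuous|exact: ZsP].
have XZ : decomposition X Zs.
  apply: (row_sequence_limit_unique sumZ).
  have -> : (fun k => \sum_j Ys (s k) j) = Xs \o s by apply/funext => k;
    exact: XYs.
  exact: (subsequence_cvg s_incr XsX).
exists Zs; first exact: XZ.
apply/ler_addgt0Pr => e e0; have e2 : 0 < e / 2 by rewrite divr_gt0.
(* The denominator is [m.+1] rather than [m], which may be 0. *)
pose d := e / 2 / m.+1%:R; have d0 : 0 < d by rewrite divr_gt0// ltr0n.
have near1 : \forall k \near \oo, forall j : 'I_m,
    kappa D z (Zs j) - d <= kappa D (y (s k)) (Ys (s k) j).
  apply: filter_forall => j; have Zj := ZsP j.
  have yZ : (fun k => (y (s k), Ys (s k) j)) @ \oo --> (z, Zs j).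
    exact: (cvg_pair (subsequence_cvg s_incr yz) Zj).
  have : \forall k \near \oo, D (y (s k)) ->
      kappa D z (Zs j) - d <= kappa D (y (s k)) (Ys (s k) j).
    exact: (yZ _ (kappa_lsc (Zs j) Dz d0)).
  by apply: filterS => k; apply; exact: Dy.
have near2 : \forall k \near \oo, \sum_j kappa D (y (s k)) (Ys (s k) j) <= c + e
  / 2.
  exact: (cvg_subsequence s_incr (Yc _ e2)).
have [k [k1 k2]] := filter_ex (filterI near1 near2).
have : \sum_j kappa D z (Zs j) - d *+ m <= \sum_j kappa D (y (s k))
  (Ys (s k) j).
  rewrite -[X in _ *+ X](card_ord m) -sumr_const -sumrB.
  by apply: ler_sum => j _; exact: k1.
have : d *+ m <= e / 2.
  rewrite /d -mulr_natr mulrAC ler_pdivrMr ?ltr0n// ler_wpM2l ?(ltW e2)//.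
  by rewrite ler_nat.
lra.
Qed.

Lemma kappa_m_attained_of_taut m z X : (0 < m)%N -> D z ->
  kappa_m_attained D m z X.
Proof.
move=> m0 Dz; have /choice[Ys YsP] : forall k : nat, exists Ys : 'I_m -> V,
    decomposition X Ys /\ \sum_j kappa D z (Ys j) < kappa_m D m z X +
      (k.+1%:R)^-1.
  move=> k; have k0 : 0 < (k.+1%:R)^-1 :> R by rewrite invr_gt0 ltr0n.
  by have [Ys XYs Ye] := kappa_m_adherent D z X m0 k0; exists Ys.
have YM k : \sum_j kappa D z (Ys k j) < kappa_m D m z X + 1.
  case: (YsP k) => _ /lt_le_trans; apply.
  by rewrite lerD2l invf_le1 ?ltr0n// ler1n.
have Yc e : 0 < e -> \forall k \near \oo,
  \sum_j kappa D z (Ys k j) <= kappa_m D m z X + e.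
  move=> e0; have := harmonic_le e0; apply: filterS => k ke.
  by case: (YsP k) => _ /ltW/le_trans; apply; rewrite lerD2l.
have [Zs XZ Zc] := kappa_m_limit Dz (fun=> Dz) (cvg_cst z) (cvg_cst X)
  (fun k => (YsP k).1) YM Yc.
exists Zs; split; first exact: XZ.
  by apply/le_anti; rewrite Zc kappa_m_le.
by move=> j; exact: kappa_attained.
Qed.

Lemma kappa_m_lsc m z X (e : R) : (0 < m)%N -> D z -> 0 < e ->
  \forall p \near (z, X), D p.1 -> kappa_m D m z X - e <= kappa_m D m p.1 p.2.
Proof.
move=> m0 Dz e0; apply: contrapT => /not_near_sequence[p pzw pP].
have {}pP k : D (p k).1 /\ kappa_m D m (p k).1 (p k).2 < kappa_m D m z X - e.
  by have := pP k; move=> /not_implyP[D1 /negP]; rewrite -ltNge.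
have p1 : (fun k => (p k).1) @ \oo --> z by exact: (cvg_comp _ _ pzw cvg_fst).
have p2 : (fun k => (p k).2) @ \oo --> X by exact: (cvg_comp _ _ pzw cvg_snd).
have /choice[Ys YsP] : forall k : nat, exists Ys : 'I_m -> V,
    decomposition (p k).2 Ys /\ \sum_j kappa D (p k).1 (Ys j) < kappa_m D m z X
      - e.
  move=> k; have [_] := pP k; rewrite -subr_gt0 => k0.
  have [Ys XYs] := kappa_m_adherent D (p k).1 (p k).2 m0 k0.
  by rewrite addrC subrK => Ye; exists Ys.
have Yc e' : 0 < e' ->
    \forall k \near \oo, \sum_j kappa D (p k).1 (Ys k j) <= kappa_m D m z X - e
      + e'.
  by move=> e'0; apply: nearW => k; case: (YsP k) => _ Ye; lra.
have [Zs XZ Zc] := kappa_m_limit Dz (fun k => (pP k).1) p1 p2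
  (fun k => (YsP k).1) (fun k => (YsP k).2) Yc.
by have := kappa_m_le D z XZ; lra.
Qed.

(** Suppose that it fails for points [y k] tending to [z] and vectors [Y k].
    By homogeneity these can be scaled to vectors [X k] with [kappa D z (X k)]
    at least 1 and [kappa D (y k) (X k)] less than 1 / (1 + e). The discs
    realizing the latter converge, so that [X k] tends to some [X'] with
    [kappa D z X'] at most 1 / (1 + e); this contradicts the upper
    semicontinuity of [kappa] at (z, X'). The estimate is uniform in [Y],
    hence it passes to sums with any number of terms. *)
Lemma kappa_comparison z (e : R) : D z -> 0 < e ->
  \forall z' \near z, D z' -> forall Y, kappa D z Y <= (1 + e) * kappa D z' Y.
Proof.
move=> Dz e0; have e1 : 0 < 1 + e by rewrite addr_gt0.
apply: contrapT => /not_near_sequence[y yz yP].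
have /choice[Y YP] : forall k, exists Y,
  D (y k) /\ (1 + e) * kappa D (y k) Y < kappa D z Y.
  move=> k; have := yP k; move=> /not_implyP[Dyk /existsNP[Y /negP]].
  by rewrite -ltNge => YY; exists Y.
pose t k := kappa D z (Y k).
have t0 k : 0 < t k.
  case: (YP k) => _; apply: le_lt_trans.
  by rewrite mulr_ge0 ?kappa_ge0// ltW.
(* Normalization: [kappa D z (Y k)] becomes 1. *)
pose X k := (((t k)^-1)%:C)%C *: Y k.
have X1 k : 1 <= kappa D z (X k).
  have := kappa_scale_le (X k) oD Dz (t0 k).
  rewrite /X scalerA -rmorphM divff ?gt_eqF// scale1r -/(t k).
  by rewrite -[leLHS]mulr1 ler_pM2l.
have Xlt k : kappa D (y k) (X k) < (1 + e)^-1.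
  have [Dyk YYk] := YP k.
  have tV : 0 < (t k)^-1 by rewrite invr_gt0.
  apply: le_lt_trans (kappa_scale_le (Y k) oD Dyk tV) _.
  by rewrite mulrC ltr_pdivrMr// mulrC ltr_pdivlMr// mulrC.
have [s s_incr [X' XX' zX']] := kappa_le_extraction (fun k => (YP k).1) Xlt Dz
  yz.
have gap : 0 < (1 - (1 + e)^-1) / 2.
  by rewrite divr_gt0// subr_gt0 invf_lt1// ltrDl.
have zX : (fun k => (z, X (s k))) @ \oo --> (z, X').
  exact: (cvg_pair (cvg_cst z) XX').
have near1 : \forall k \near \oo, kappa D z (X (s k)) <= kappa D z X' +
  (1 - (1 + e)^-1) / 2.
  exact: (zX _ (kappa_usc X' oD Dz gap)).
have [k k1] := filter_ex near1.
by have := X1 (s k); lra.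
Qed.

Lemma kappa_hat_ge0 z X : 0 <= kappa_hat D z X.
Proof. by apply: ge0_inf => _ [m _ <-]; exact: kappa_m_ge0. Qed.

Lemma kappa_hat_comparison z z' (c : R) : 0 < c ->
  (forall Y, kappa D z Y <= c * kappa D z' Y) ->
  forall X, kappa_hat D z X <= c * kappa_hat D z' X.
Proof.
move=> c0 zz' X; apply/ler_addgt0Pr => e e0.
have ec : 0 < e / c / 2 by rewrite !divr_gt0.
have [m m0 me] := kappa_hat_adherent D z' X ec.
have [Ys XYs Ye] := kappa_m_adherent D z' X m0 ec.
apply: le_trans (kappa_hat_le D z X m0) _;
  apply: le_trans (kappa_m_le D z XYs) _.
apply: (@le_trans _ _ (c * \sum_j kappa D z' (Ys j))).
  by rewrite mulr_sumr; apply: ler_sum => j _; exact: zz'.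
have : \sum_j kappa D z' (Ys j) <= kappa_hat D z' X + e / c.
  rewrite [e / c]splitr addrA; apply/ltW/(lt_trans Ye).
  by rewrite ltrD2r.
by rewrite -(ler_pM2l c0) mulrDr (mulrC c (e / c)) divfK// gt_eqF.
Qed.

(** Append [Y] to a decomposition of [X]. *)
Lemma kappa_hat_triangle z X Y :
  kappa_hat D z (X + Y) <= kappa_hat D z X + kappa D z Y.
Proof.
apply/ler_addgt0Pr => e e0; have e2 : 0 < e / 2 by rewrite divr_gt0.
have [m m0 me] := kappa_hat_adherent D z X e2.
have [Ys XYs Ye] := kappa_m_adherent D z X m0 e2.
pose Zs (j : 'I_(m + 1)) :=
  match fintype.split j with inl i => Ys i | inr _ => Y end.
have Zl i : Zs (lshift 1 i) = Ys i.
  by rewrite /Zs -[lshift 1 i]/(unsplit (inl i)) unsplitK.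
have Zr i : Zs (rshift m i) = Y.
  by rewrite /Zs -[rshift m i]/(unsplit (inr i)) unsplitK.
have XZ : decomposition (X + Y) Zs.
  rewrite /decomposition big_split_ord/= big_ord1 Zr; congr (_ + _).
  by rewrite -XYs; apply: eq_bigr => i _; rewrite Zl.
apply: le_trans (kappa_hat_le D z (X + Y) (ltn_addr 1 m0)) _.
apply: le_trans (kappa_m_le D z XZ) _.
rewrite big_split_ord/= big_ord1 Zr; under eq_bigr do rewrite Zl.
lra.
Qed.

(** The number of vectors in a decomposition being unbounded, decompositions
    need not have limits. Instead [kappa_comparison] compares [kappa_hat] at
    [z] and at a nearby point for the same vector, and the triangle inequality
    compares two vectors at [z]. *)
Lemma kappa_hat_lsc z X (e : R) : D z -> 0 < e ->
  \forall p \near (z, X), D p.1 -> kappa_hat D z X - e <= kappa_hat D p.1 p.2.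
Proof.
move=> Dz e0; have e2 : 0 < e / 2 by rewrite divr_gt0.
pose K := kappa_hat D z X + 1; have K0 : 0 < K
  by rewrite ltr_wpDl// kappa_hat_ge0.
pose d := e / 2 / K; have d0 : 0 < d by rewrite !divr_gt0.
have near1 : \forall p \near (z, X), kappa_hat D p.1 p.2 <= K.
  exact: (kappa_hat_usc oD X Dz ltr01).
have near2 : \forall p \near (z, X), D p.1 ->
  forall Y, kappa D z Y <= (1 + d) * kappa D p.1 Y.
  exact: (@cvg_fst _ _ (nbhs z) (nbhs X) _ _ (kappa_comparison Dz d0)).
have near3 : \forall p \near (z, X), kappa D z (X - p.2) <= e / 2.
  have zX : (fun p : V * V => (z, X - p.2)) @ nbhs (z, X) --> (z, (0 : V)).
    have c2 : (fun p : V * V => X - p.2) @ nbhs (z, X) --> (0 : V).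
      by rewrite -(subrr X); apply: cvgB; [exact: cvg_cst|exact: cvg_snd].
    exact: (cvg_pair (cvg_cst z) c2).
  have := zX _ (kappa_usc 0 oD Dz e2); rewrite kappa0// add0r; exact.
apply: filterS3 near1 near2 near3 => p p1 p2 p3 Dp.
have d1 : 0 < 1 + d by rewrite addr_gt0.
have h1 := kappa_hat_comparison d1 (p2 Dp) p.2.
have h2 := kappa_hat_triangle z p.2 (X - p.2).
rewrite addrC subrK in h2.
have h3 : d * kappa_hat D p.1 p.2 <= e / 2.
  by rewrite -[leRHS](@divfK _ K) ?gt_eqF// ler_pM2l.
lra.
Qed.

End TautKappa.

(** * Continuity from the two semicontinuities *)

Section Continuity.
Context {R : realType} {n : nat}.
Notation C := (Cplx R).
Notation V := 'rV[C]_n.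

Lemma continuous_of_semicontinuous (A B : set V) (F : V * V -> R) :
  (forall z w (e : R), A z -> B w -> 0 < e ->
    \forall p \near (z, w), F p <= F (z, w) + e) ->
  (forall z w (e : R), A z -> B w -> 0 < e ->
     \forall p \near (z, w), A p.1 -> B p.2 -> F (z, w) - e <= F p) ->
  {within A `*` B, continuous F}.
Proof.
move=> Fusc Flsc; apply/subspace_continuousP => -[z w] /= [Az Bw].
apply/cvgrPdist_le => e e0; rewrite near_withinE.
have h1 := Fusc z w e Az Bw e0; have h2 := Flsc z w e Az Bw e0.
apply: filterS2 h1 h2 => p p1 p2 [A1 B2]; have {}p2 := p2 A1 B2.
by rewrite ler_distlC; apply/andP; split; [exact: p2|exact: p1].
Qed.

End Continuity.

Theorem proposition4 (R : realType) (n : nat) :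
  (forall D : set 'rV[Cplx R]_n, domain D ->
     [/\ usc_on_uniformly (D `*` D) (fun m p => lempert_m D m p.1 p.2),
         usc_on_uniformly (D `*` D) (fun m p => ell_m D m p.1 p.2),
         usc_on_uniformly (D `*` setT) (fun m p => kappa_m D m p.1 p.2) &
         usc_on (D `*` setT) (fun p => kappa_hat D p.1 p.2)])
  /\
  (forall D : set 'rV[Cplx R]_n, domain D -> taut D ->
     (forall m : nat, (0 < m)%N ->
        [/\ forall z w, D z -> D w -> chain_inf_attained D (lempert D) m z w,
            forall z w, D z -> D w -> chain_inf_attained D (ell D) m z w &
            forall z X, D z -> kappa_m_attained D m z X] /\
        [/\ {within D `*` D, continuous (fun p => lempert_m D m p.1 p.2)},
            {within D `*` D, continuous (fun p => ell_m D m p.1 p.2)} &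
            {within D `*` setT, continuous (fun p => kappa_m D m p.1 p.2)}]) /\
     {within D `*` setT, continuous (fun p => kappa_hat D p.1 p.2)}).
Proof.
have ell_pos (D : set 'rV[Cplx R]_n) z w : D z -> D w -> 0 <= ell D z w.
  by move=> _ _; exact: ell_ge0.
have lem_pos (D : set 'rV[Cplx R]_n) z w : domain D -> D z -> D w ->
  0 <= lempert D z w.
  by move=> dD Dz Dw; apply: lempert_ge0; exact: ell_lt1.
split=> D dD; have [oD _ _] := dD.
  split.
  - apply: chain_inf_usc_uniformly => //.
    + by move=> z w; exact: lem_pos.
    + exact: lempert_refl.
    + by move=> z w e; exact: lempert_usc.
  - apply: chain_inf_usc_uniformly => //.
    + exact: ell_pos.
    + exact: ell_refl.
    + by move=> z w e; exact: ell_usc.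
  - exact: kappa_m_usc_uniformly.
  - move=> [z X] [/= Dz _] e e0; rewrite near_withinE.
    by have := kappa_hat_usc oD X Dz e0; apply: filterS => p + _.
move=> tautD; split=> [m m0|]; last first.
  apply: continuous_of_semicontinuous => //.
  - by move=> z X e Dz _; exact: kappa_hat_usc.
  - move=> z X e Dz _ e0.
    by have := kappa_hat_lsc oD tautD X Dz e0; apply: filterS => p + Dp _;
      exact.
(* A bound on the sum bounds each Lempert distance [artanh ell], hence keeps
   [ell] away from 1. *)
have lem_coercive z w : D z -> D w -> exists b rho : R,
    [/\ chain_inf D (lempert D) m z w < b, rho < 1 &
        forall x y, D x -> D y -> lempert D x y < b -> ell D x y < rho].
  move=> Dz Dw; pose b := chain_inf D (lempert D) m z w + 1.
  exists b, (tanh b); split; first by rewrite ltrDl.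
    by case/andP: (tanh_itv b).
  by move=> x y Dx Dy; apply: lt_tanh_artanh; exact: ell_itv.
(* Here the sum has to be less than 1; it can be, because the infimum is at
   most the value [ell D z w] < 1 of the one-step chain. *)
have ell_coercive z w : D z -> D w -> exists b rho : R,
    [/\ chain_inf D (ell D) m z w < b, rho < 1 &
        forall x y, D x -> D y -> ell D x y < b -> ell D x y < rho].
  move=> Dz Dw; have l1 := ell_lt1 dD Dz Dw.
  exists ((ell D z w + 1) / 2), ((ell D z w + 1) / 2); split => //; last by lra.
  apply: (@le_lt_trans _ _ (ell D z w)); last by lra.
  have := chain_inf_decreasing (@ell_pos D) (@ell_refl _ _ D) m.-1 (ltnSn 0) Dz
    Dw.
  rewrite add1n prednK// => /le_trans; apply.
  apply: le_trans (chain_inf_le (@ell_pos D)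
    (y := fun j => if j is 0%N then z else w) _) _.
    by split => // -[].
  by rewrite /chain_sum big_ord1.
have lem_lsc := @lempert_lsc _ _ _ dD tautD.
have l_lsc := @ell_lsc _ _ _ dD tautD.
split; split.
- move=> z w Dz Dw; have [b [rho [zb rho1 co]]] := lem_coercive z w Dz Dw.
  exact: (chain_inf_attained_of_coercive dD tautD (fun x y => @lem_pos D x y dD)
    lem_lsc
    m0 Dz Dw zb rho1 co).
- move=> z w Dz Dw; have [b [rho [zb rho1 co]]] := ell_coercive z w Dz Dw.
  exact: (chain_inf_attained_of_coercive dD tautD (@ell_pos D) l_lsc
    m0 Dz Dw zb rho1 co).
- by move=> z X Dz; exact: kappa_m_attained_of_taut.
- apply: continuous_of_semicontinuous => // z w e Dz Dw e0.
    apply: (chain_inf_usc (f := lempert D)) => //.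
    + by move=> x y; exact: lem_pos.
    + by move=> x y e'; exact: lempert_usc.
  have [b [rho [zb rho1 co]]] := lem_coercive z w Dz Dw.
  exact: (chain_inf_lsc dD tautD (fun x y => @lem_pos D x y dD) lem_lsc
    m0 Dz Dw zb rho1 co e0).
- apply: continuous_of_semicontinuous => // z w e Dz Dw e0.
    apply: (chain_inf_usc (f := ell D)) => //.
    + exact: ell_pos.
    + by move=> x y e'; exact: ell_usc.
  have [b [rho [zb rho1 co]]] := ell_coercive z w Dz Dw.
  exact: (chain_inf_lsc dD tautD (@ell_pos D) l_lsc m0 Dz Dw zb rho1 co e0).
- apply: continuous_of_semicontinuous => //.
  + by move=> z X e Dz _; exact: kappa_m_usc.
  + move=> z X e Dz _ e0.
    by have := kappa_m_lsc oD tautD X m0 Dz e0; apply: filterS => p + Dp _;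
      exact.
Qed.
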